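(* (Tanaka formula for $d=2$.) Let $X$ be a super-Brownian motion in $\mathbb{R}^2$ with $X_0=\delta_0$, with local time $L_t^x$ at $x$ and time $t$. Let $c_2=\frac1\pi$ and $g_x(y)=\log|y-x|$ for $y\in\mathbb{R}^2$, where $x\in\mathbb{R}^2\setminus\{0\}$. Then for every $t>0$, almost surely, $$L_t^x=c_2\Big[X_t(g_x)-\delta_0(g_x)-M_t(g_x)\Big].$$
   Context: $M_F=M_F(\mathbb{R}^d)$ is the space of finite Borel measures on $\mathbb{R}^d$ with the topology of weak convergence; $\mu(\phi)=\int\phi\,d\mu$, so $\delta_0(g_x)=g_x(0)=\log|x|$. Here $d=2$. Super-Brownian motion $X$ started at $\mu\in M_F$ is the continuous $M_F$-valued adapted strong Markov process on a filtered probability space $(\Omega,\mathcal{F},\mathcal{F}_t,P)$, unique in law, with $X_0=\mu$ a.s. solving the martingale problem: for every $\phi\in C_b^2(\mathbb{R}^d)$, $X_t(\phi)=X_0(\phi)+M_t(\phi)+\int_0^t X_s(\frac{\Delta}{2}\phi)\,ds$, where $M_t(\phi)$ is a continuous $\mathcal{F}_t$-martingale with $M_0(\phi)=0$ and quadratic variation $[M(\phi)]_t=\int_0^t X_s(\phi^2)\,ds$. The linear map $\phi\mapsto M(\phi)$ extends uniquely, by the isometry $E[M_t(\phi)^2]=E\int_0^tX_s(\phi^2)\,ds$ ($L^2$ limits), to all Borel $\phi$ with $E\int_0^tX_s(\phi^2)\,ds<\infty$ for all $t$; $M(\phi)$ is then a martingale with quadratic variation $\int_0^tX_s(\phi^2)\,ds$.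 $M_t(g_x)$ is understood in this sense. With $p_t(x)=(2\pi t)^{-d/2}e^{-|x|^2/2t}$ and $p_\epsilon^x(y)=p_\epsilon(y-x)$, the local time of $X$ at $x\ne0$ and time $t$ is $L_t^x=\lim_{\epsilon\to0}\int_0^t X_s(p_\epsilon^x)\,ds$ (a.s. limit). *)

(* Defs.v *)
From HB Require Import structures.
From mathcomp Require Import all_boot all_order all_algebra.
From mathcomp Require Import all_classical all_reals all_analysis.
Set Implicit Arguments.
Unset Strict Implicit.
Unset Printing Implicit Defensive.
Import Order.TTheory GRing.Theory Num.Theory.
Import numFieldNormedType.Exports.
Local Open Scope classical_set_scope.
Local Open Scope ring_scope.

(* The plane is [R * R]: its library topology (sup norm) is the Euclidean one,
   and its library sigma-algebra, the product of the Borel sigma-algebras, is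
   the Borel one.  The library norm [`|y|] of a pair is the sup norm, hence: *)
Definition enorm {R : realType} (y : R * R) : R :=
  Num.sqrt (y.1 ^+ 2 + y.2 ^+ 2).

Section FunctionClasses.
Context {R : realType}.
Implicit Types phi : R * R -> R.

Definition Cb phi : Prop := continuous phi /\ bounded_fun phi.

Definition basis_vec (i : 'I_2) : R * R := ((i == 0)%:R, (i == 1)%:R).

Definition partial (i : 'I_2) phi : R * R -> R :=
  fun y => 'D_(basis_vec i) phi y.

Definition Cb2 phi : Prop :=
  [/\ Cb phi,
      forall i, (forall y, derivable phi y (basis_vec i)) /\ Cb (partial i phi)
    & forall i j, (forall y, derivable (partial i phi) y (basis_vec j)) /\
                  Cb (partial j (partial i phi))].

Definition laplacian phi : R * R -> R :=
  fun y => \sum_(i < 2) partial i (partial i phi) y.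

(* [ln 0 = 0] in the library, so [log_dist x x = 0] instead of [-oo]. *)
Definition log_dist (x : R * R) : R * R -> R := fun y => ln (enorm (y - x)).

(* [p_t(y) = (2 pi t)^(-d/2) exp(-|y|^2 / 2t)] with [d = 2] *)
Definition heat_kernel (t : R) (y : R * R) : R :=
  (2 * pi * t)^-1 * expR (- (enorm y ^+ 2 / (2 * t))).

End FunctionClasses.

Section FiniteMeasures.
Variable R : realType.

Definition fin_measure : Type := {finite_measure set (R * R)%type -> \bar R}.
HB.instance Definition _ := gen_eqMixin fin_measure.
HB.instance Definition _ := gen_choiceMixin fin_measure.

Definition test_integrals (mu : fin_measure) :
    {ptws {phi : R * R -> R | Cb phi} -> R} :=
  fun phi => \int[mu]_y sval phi y.

(* The weak topology on finite measures: the coarsest one making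
   [mu |-> mu(phi)] continuous for all bounded continuous [phi]. *)
Definition MF : Type := initial_topology test_integrals.
HB.instance Definition _ := Topological.on MF.
HB.instance Definition _ := isPointed.Build MF (mzero : fin_measure).

Definition borelMF := g_sigma_algebraType (@open MF).

Definition MF_measure (mu : MF) : {finite_measure set (R * R)%type -> \bar R} :=
  mu.

End FiniteMeasures.
Coercion MF_measure : MF >-> FiniteMeasure.type.

(* Processes are indexed by [R]; only times [t >= 0] matter. *)
Section Processes.
Context {R : realType} {d : measure_display} {T : measurableType d}.
Variable P : probability T R.
Variable F : R -> set (set T).

Record filtration : Prop := {
  filtration_sigma : forall t, 0 <= t -> sigma_algebra setT (F t);
  filtration_measurable : forall t, 0 <= t -> F t `<=` measurable;
  filtration_mono : forall s t, 0 <= s -> s <= t -> F s `<=` F t }.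

Definition adapted d' (E : measurableType d') (X : R -> T -> E) : Prop :=
  forall t, 0 <= t -> forall B, measurable B -> F t (X t @^-1` B).

Definition continuous_paths (E : topologicalType) (X : R -> T -> E) : Prop :=
  forall w, {within [set t | 0 <= t], continuous (X ^~ w)}.

(* [E[N_t | F_s] = N_s] is expressed by integration over the events of [F_s]. *)
Definition martingale (N : R -> T -> R) : Prop :=
  [/\ adapted N,
      forall t, 0 <= t -> P.-integrable setT (EFin \o N t)
    & forall s t, 0 <= s -> s <= t -> forall A, F s A ->
        (\int[P]_(w in A) (N t w)%:E = \int[P]_(w in A) (N s w)%:E)%E].

Definition stopping_time (tau : T -> \bar R) : Prop :=
  (forall w, (0 <= tau w)%E) /\
  (forall t, 0 <= t -> F t [set w | (tau w <= t%:E)%E]).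

Definition stopped_sigma (tau : T -> \bar R) : set (set T) :=
  [set A | measurable A /\
    forall t, 0 <= t -> F t (A `&` [set w | (tau w <= t%:E)%E])].

Definition stopped (tau : T -> \bar R) (N : R -> T -> R) : R -> T -> R :=
  fun t w => N (fine (mine t%:E (tau w))) w.

Definition continuous_local_martingale (N : R -> T -> R) : Prop :=
  [/\ adapted N, continuous_paths N, forall w, N 0 w = 0 &
      exists tau : nat -> T -> \bar R,
        [/\ forall n, stopping_time (tau n),
            forall n w, (tau n w <= tau n.+1 w)%E,
            {ae P, forall w, tau n w @[n --> \oo] --> +oo%E}
          & forall n, martingale (stopped (tau n) N)]].

(* [A] is the quadratic variation of the continuous martingale [N] with
   [N_0 = 0]: the increasing process such that [N^2 - A] is a continuous
   local martingale. *)
Definition quadratic_variation (N A : R -> T -> R) : Prop :=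
  [/\ adapted A, continuous_paths A, forall w, A 0 w = 0,
      forall w s t, 0 <= s -> s <= t -> A s w <= A t w
    & continuous_local_martingale (fun t w => N t w ^+ 2 - A t w)].

Definition strong_markov (X : R -> T -> borelMF R) : Prop :=
  exists Q : R -> R.-pker (borelMF R) ~> (borelMF R),
    [/\ forall nu B, measurable B -> Q 0 nu B = \d_nu B,
        forall s t : R, 0 <= s -> 0 <= t -> forall nu B, measurable B ->
          (Q (s + t)%R nu B = \int[Q s nu]_nu' Q t nu' B)%E
      & forall tau, stopping_time tau -> forall s : R, 0 <= s ->
          forall A, stopped_sigma tau A -> A `<=` [set w | (tau w < +oo)%E] ->
          forall B, measurable B ->
          P (A `&` [set w | B (X (fine (tau w) + s)%R w)]) =
          (\int[P]_(w in A) Q s (X (fine (tau w)) w) B)%E].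

Variable X : R -> T -> MF R.

(* [M_t(phi)] for [phi] of class [C_b^2], as given by the equation of the
   martingale problem *)
Definition mp_martingale (phi : R * R -> R) : R -> T -> R := fun t w =>
  \int[X t w]_y phi y - \int[X 0 w]_y phi y -
  \int[lebesgue_measure]_(s in `[0, t])
    \int[X s w]_y (2^-1 * laplacian phi y).

Record super_brownian_motion (mu : {finite_measure set (R * R)%type -> \bar R})
    : Prop := {
  sbm_continuous : continuous_paths X;
  sbm_adapted : adapted (X : R -> T -> borelMF R);
  sbm_strong_markov : strong_markov X;
  sbm_init : {ae P, forall w, forall B, measurable B -> X 0 w B = mu B};
  sbm_mp : forall phi, Cb2 phi ->
    [/\ martingale (mp_martingale phi), continuous_paths (mp_martingale phi),
        forall w, mp_martingale phi 0 w = 0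
      & quadratic_variation (mp_martingale phi)
          (fun t w => \int[lebesgue_measure]_(s in `[0, t])
                        \int[X s w]_y (phi y ^+ 2))] }.

(* [E (\int_0^t X_s(phi^2) ds)] *)
Definition energy (phi : R * R -> R) (t : R) : \bar R :=
  (\int[P]_w \int[lebesgue_measure]_(s in `[0%R, t])
     \int[X s w]_y ((phi y) ^+ 2)%:E)%E.

Definition finite_energy (phi : R * R -> R) : Prop :=
  measurable_fun setT phi /\ forall t, 0 <= t -> (energy phi t < +oo)%E.

(* [M] is the linear isometric extension of [phi |-> M(phi)] from [C_b^2] to
   all Borel functions of finite energy; as [C_b^2] is dense, it is unique
   up to null sets. *)
Record martingale_extension (M : (R * R -> R) -> R -> T -> R) : Prop := {
  mext_rv : forall phi, finite_energy phi -> forall t, 0 <= t ->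
    measurable_fun setT (M phi t);
  mext_Cb2 : forall phi, Cb2 phi -> forall t, 0 <= t ->
    {ae P, forall w, M phi t w = mp_martingale phi t w};
  mext_linear : forall (a : R) phi psi,
    finite_energy phi -> finite_energy psi -> forall t, 0 <= t ->
    {ae P, forall w, M (a *: phi + psi) t w = a * M phi t w + M psi t w};
  mext_isometry : forall phi, finite_energy phi -> forall t, 0 <= t ->
    (\int[P]_w ((M phi t w) ^+ 2)%:E = energy phi t)%E }.

Definition local_time (x : R * R) (t : R) (L : T -> R) : Prop :=
  {ae P, forall w,
    \int[lebesgue_measure]_(s in `[0, t])
      \int[X s w]_y heat_kernel e (y - x) @[e --> 0^'+] --> L w}.

End Processes.

(* Main.v *)
Require Import Defs.
From HB Require Import structures.
From mathcomp Require Import all_boot all_order all_algebra.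
From mathcomp Require Import all_classical all_reals all_analysis.
From mathcomp Require Import measurable_realfun.
From mathcomp Require Import ring lra.
(** Half the Laplacian of [log |y - x|] is [pi] times the Dirac mass at [x], so
    the formula is the equation of the martingale problem for the logarithm,
    the time integral being [pi] times the local time. The logarithm is
    unbounded at [x] and at infinity, and the formula is obtained as a limit.

    Put [q = |y - x|^2]. By Frullani, [log |y - x| = (ln q) / 2] is the integral
    over [u > 0] of [(expR (- u) - expR (- u q)) / (2 u)]. Its truncation to
    [[expR (- n), expR n]], called [logprof n], is a bounded smooth function of
    [q] with three properties: half its Laplacian is exactly [pi] times the heat
    kernel at time [expR (- n) / 2], minus a remainder bounded by [expR (- n)]
    ([logprof_Cb2], [lint2E]); its absolute value is at most that of the
    logarithm; and it converges to the logarithm off [x] ([logprof_ln_incr]).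
    In the martingale problem for [logprof n] the time integral thus converges
    to [pi] times the local time, by definition of the latter
    ([local_time_seq]).

    The other terms converge by dominated convergence once the logarithm is
    integrable enough, for the mean measure [E X_t] and for the occupation
    measure [E int_0^t X_s ds]. The martingale problem itself gives these
    bounds: taking expectations, a test function [phi] yields
    [E X_t(phi) = phi 0 + E int_0^t X_s(half Laplacian of phi) ds], and comparing
    [phi] and its Laplacian with other functions gives inequalities
    ([moment_le]). Bounded truncations of [q] give second moments
    ([mean_sqdist]). The function [- logprof n] gives the integrability of the
    logarithm under the mean measure ([mean_log]); this uses [x <> 0]. The
    function [1 / (1 + |y - x|)], whose Laplacian behaves like
    [- 1 / |y - x|] near [x], gives the integrability of the squared logarithm
    under the occupation measure ([occupation_log]). The same estimates show that
    neither measure charges [x], where the logarithm is infinite while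
    [log_dist x x = 0].

    These expectations make sense because [X] is a measurable kernel from
    [T * R] to the plane: tested on bounded continuous functions it is measurable
    in the event and continuous in time ([caratheodory]), and such functions
    determine measurability on all Borel sets ([kernel_of_Cb]).

    Finally the isometry turns [E int_0^t X_s((logprof n - log)^2) ds -> 0] into
    mean-square convergence of the extended martingales, whose pathwise limit
    is known from the martingale problem; the two limits coincide
    ([ae_lim0_of_integral_cvg0], [tanaka]). *)

Set Implicit Arguments.
Unset Strict Implicit.
Unset Printing Implicit Defensive.
Import Order.TTheory GRing.Theory Num.Theory.
Import numFieldNormedType.Exports.
Local Open Scope classical_set_scope.
Local Open Scope ring_scope.

(** * Radial test functions *)
Section Radial.
Context {R : realType}.
Implicit Types (x y v : R * R) (h : R -> R).

Definition sqdist x y : R := (y.1 - x.1) ^+ 2 + (y.2 - x.2) ^+ 2.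

Lemma sqdist_ge0 x y : 0 <= sqdist x y.
Proof. by rewrite addr_ge0 ?sqr_ge0. Qed.

Lemma sqdist_eq0 x y : (sqdist x y == 0) = (y == x).
Proof.
rewrite /sqdist paddr_eq0 ?sqr_ge0// !sqrf_eq0 !subr_eq0.
by case: x y => x1 x2 [y1 y2].
Qed.

Lemma sqdist_gt0 x y : (0 < sqdist x y) = (y != x).
Proof. by rewrite lt_def sqdist_ge0 andbT sqdist_eq0. Qed.

Lemma enormB_sqr x y : enorm (y - x) ^+ 2 = sqdist x y.
Proof. by rewrite /enorm sqr_sqrtr// addr_ge0 ?sqr_ge0. Qed.

Lemma fst_continuous : continuous (fst : R * R -> R).
Proof. by case=> a b; exact: cvg_fst. Qed.

Lemma snd_continuous : continuous (snd : R * R -> R).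
Proof. by case=> a b; exact: cvg_snd. Qed.

Lemma continuous_sqdist x : continuous (sqdist x).
Proof.
have c1 : continuous (fun z : R * R => z.1 - x.1).
  by move=> y; apply: continuousB; [exact: fst_continuous|exact: cvg_cst].
have c2 : continuous (fun z : R * R => z.2 - x.2).
  by move=> y; apply: continuousB; [exact: snd_continuous|exact: cvg_cst].
by move=> y; exact: (continuousD (continuousM (c1 y) (c1 y))
  (continuousM (c2 y) (c2 y))).
Qed.

Definition coord (i : 'I_2) y : R := if i == 0 then y.1 else y.2.

Lemma continuous_coord i : continuous (coord i).
Proof.
move=> y; rewrite /continuous_at /coord.
by case: (i == 0); [exact: fst_continuous|exact: snd_continuous].
Qed.

(** A directional derivative only sees the restriction to a line, so that the
    one-dimensional calculus applies to partial derivatives. *)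
Lemma is_derive_line (f : R * R -> R) y v d :
  is_derive (0 : R) (1 : R) (fun t : R => f (y + t *: v)) d -> is_derive y v f d.
Proof.
have e : (fun h : R => h^-1 *: ((f \o shift y) (h *: v) - f y)) =
    (fun h : R => h^-1 *: (((fun t : R => f (y + t *: v)) \o shift 0) (h *: 1)
       - f (y + 0 *: v))).
  apply/funext => h /=; rewrite scale0r addr0 [h *: 1]mulr1.
  by rewrite /shift/= addr0 [y + _]addrC.
move=> [d1 d2]; split; first by rewrite /derivable e.
by move: d2; rewrite /derive e.
Qed.

Lemma coord_basis_vec i j : coord i (basis_vec j) = (i == j)%:R :> R.
Proof. by case: i => [[|[|[]]]]//= ?; case: j => [[|[|[]]]]//= ?. Qed.

Lemma coordDZ i y v (t : R) : coord i (y + t *: v) = coord i y + t * coord i v.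
Proof. by rewrite /coord; case: (i == 0). Qed.

Lemma sqdistE x y : sqdist x y = \sum_(i < 2) (coord i y - coord i x) ^+ 2.
Proof. by rewrite big_ord_recr big_ord1. Qed.

Lemma sqdist_line x i y (t : R) :
  sqdist x (y + t *: basis_vec i) =
  sqdist x y + 2 * (coord i y - coord i x) * t + t ^+ 2.
Proof.
rewrite !sqdistE !big_ord_recr !big_ord0 /= !coordDZ !coord_basis_vec.
by case: i => [[|[|[]]]]//= ?; rewrite ?eqE /=; ring.
Qed.

Lemma is_derive_sqdist_line x i y :
  is_derive (0 : R) (1 : R) (fun t : R => sqdist x (y + t *: basis_vec i))
    (2 * (coord i y - coord i x)).
Proof.
rewrite (_ : (fun t => _) = (fun t : R => sqdist x y + 2 * (coord i y - coord i x) * t + t ^+ 2)).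
  apply: is_derive_eq; rewrite !(scaler0, add0r, expr0n, mulr0n) /= ?mulr0 ?addr0 ?scale0r ?addr0.
  by rewrite mul1r [_%:A]mulr1.
by apply/funext => t; rewrite sqdist_line.
Qed.

Lemma is_derive_radial_line x i y h dh :
  is_derive (sqdist x y) (1 : R) h dh ->
  is_derive (0 : R) (1 : R) (fun t : R => h (sqdist x (y + t *: basis_vec i)))
    (dh * (2 * (coord i y - coord i x))).
Proof.
move=> hd; have := is_derive_sqdist_line x i y.
by apply: is_derive1_comp; rewrite scale0r addr0.
Qed.

Lemma is_derive_radial x i y h dh :
  is_derive (sqdist x y) (1 : R) h dh ->
  is_derive y (basis_vec i) (h \o sqdist x) (2 * (coord i y - coord i x) * dh).
Proof.
move=> hd; apply: is_derive_line; rewrite mulrC.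
exact: (is_derive_radial_line _ hd).
Qed.

Lemma is_derive_coordM_radial x i j y h dh :
  is_derive (sqdist x y) (1 : R) h dh ->
  is_derive y (basis_vec j)
    (fun z => 2 * (coord i z - coord i x) * h (sqdist x z))
    (2 * (i == j)%:R * h (sqdist x y)
     + 4 * (coord i y - coord i x) * (coord j y - coord j x) * dh).
Proof.
move=> hd; apply: is_derive_line.
have h1 : is_derive (0 : R) (1 : R)
    (fun t : R => 2 * (coord i (y + t *: basis_vec j) - coord i x))
    (2 * (i == j)%:R).
  rewrite (_ : (fun _ => _) =
      (fun t : R => 2 * (coord i y - coord i x) + (2 * (i == j)%:R) * t)).
    by apply: is_derive_eq; rewrite add0r mul1r [_%:A]mulr1.
  by apply/funext => t; rewrite coordDZ coord_basis_vec; ring.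
apply: (is_derive_eq (is_deriveM h1 (is_derive_radial_line j hd))).
by rewrite scale0r addr0 /GRing.scale/=; ring.
Qed.

Lemma continuous_radial x h :
  (forall q : R, 0 <= q -> {for q, continuous h}) -> continuous (h \o sqdist x).
Proof.
by move=> hc y; apply: continuous_comp; [exact: continuous_sqdist|exact/hc/sqdist_ge0].
Qed.

Lemma coord_sqr_le x i y : (coord i y - coord i x) ^+ 2 <= sqdist x y.
Proof. by rewrite sqdistE (bigD1 i)//= lerDl sumr_ge0// => j _; exact: sqr_ge0. Qed.

Lemma coord_mul_le x i j y :
  `|(coord i y - coord i x) * (coord j y - coord j x)| <= sqdist x y.
Proof.
have := coord_sqr_le x i y; have := coord_sqr_le x j y.
move: (coord i y - _) (coord j y - _) => a b.
rewrite -[a ^+ 2]real_normK ?num_real// -[b ^+ 2]real_normK ?num_real// normrM.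
by have := normr_ge0 a; have := normr_ge0 b; have := sqr_ge0 (`|a| - `|b|); nra.
Qed.

(** A crude bound, sufficient against profiles whose derivative is
    [O(1 / (1 + q))]. *)
Lemma coord_norm_le x i y : `|coord i y - coord i x| <= 1 + sqdist x y.
Proof.
have := coord_sqr_le x i y; move: (coord i y - _) => a.
rewrite -[a ^+ 2]real_normK ?num_real//.
by have := normr_ge0 a; have := sqr_ge0 (`|a| - 1); nra.
Qed.

Lemma bounded_funP (f : R * R -> R) (C : R) :
  (forall y, `|f y| <= C) -> bounded_fun f.
Proof.
move=> fC; exists C; split; first exact: num_real.
by move=> M CM y _; exact: le_trans (fC y) (ltW CM).
Qed.

(** The gradient of [h (q)] is of order [sqrt q * h1] and the Hessian of order
    [h1 + q * h2], so decay of [h1] and [h2] like [1 / q] keeps both bounded.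
    Only [q >= 0] matters: the profiles may be singular at negative [q]. *)
Lemma radial_Cb2 x h h1 h2 (C : R) :
  (forall q : R, 0 <= q -> is_derive q (1 : R) h (h1 q)) ->
  (forall q : R, 0 <= q -> is_derive q (1 : R) h1 (h2 q)) ->
  (forall q : R, 0 <= q -> {for q, continuous h2}) ->
  (forall q : R, 0 <= q -> `|h q| <= C) ->
  (forall q : R, 0 <= q -> (1 + q) * `|h1 q| <= C) ->
  (forall q : R, 0 <= q -> (1 + q) * `|h2 q| <= C) ->
  Cb2 (h \o sqdist x) /\
  forall y, 2^-1 * laplacian (h \o sqdist x) y =
            2 * (h1 (sqdist x y) + sqdist x y * h2 (sqdist x y)).
Proof.
move=> dh dh1 ch2 hC h1C h2C.
have cont_derive (k k' : R -> R) :
    (forall q : R, 0 <= q -> is_derive q (1 : R) k (k' q)) ->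
    forall q : R, 0 <= q -> {for q, continuous k}.
  by move=> kk' q q0; apply/differentiable_continuous/derivable1_diffP; case: (kk' q q0).
have d1 i y : is_derive y (basis_vec i) (h \o sqdist x)
    (2 * (coord i y - coord i x) * h1 (sqdist x y)).
  exact/is_derive_radial/dh/sqdist_ge0.
have p1 i : partial i (h \o sqdist x) =
    (fun y => 2 * (coord i y - coord i x) * h1 (sqdist x y)).
  by apply/funext => y; rewrite /partial; exact: derive_val.
have d2 i j y : is_derive y (basis_vec j) (partial i (h \o sqdist x))
    (2 * (i == j)%:R * h1 (sqdist x y)
     + 4 * (coord i y - coord i x) * (coord j y - coord j x) * h2 (sqdist x y)).
  by rewrite p1; exact/is_derive_coordM_radial/dh1/sqdist_ge0.
have p2 i j : partial j (partial i (h \o sqdist x)) =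
    (fun y => 2 * (i == j)%:R * h1 (sqdist x y)
     + 4 * (coord i y - coord i x) * (coord j y - coord j x) * h2 (sqdist x y)).
  by apply/funext => y; rewrite {1}/partial; exact: derive_val.
have ccoord i : continuous (fun y => coord i y - coord i x).
  by move=> y; apply: continuousB; [exact: continuous_coord|exact: cvg_cst].
have ch1 : continuous (h1 \o sqdist x) := continuous_radial (cont_derive _ _ dh1).
have {}ch2 : continuous (h2 \o sqdist x) := continuous_radial ch2.
split; last first.
  move=> y; rewrite /laplacian big_ord_recr big_ord1 /= !p2 sqdistE.
  by rewrite big_ord_recr big_ord1 !eqxx /=; field.
split.
- split; first exact: continuous_radial (cont_derive _ _ dh).
  by apply: (@bounded_funP _ C) => y; exact/hC/sqdist_ge0.
- move=> i; split; first by move=> y; case: (d1 i y).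
  rewrite p1; split.
    move=> y; apply: (@continuousM _ _ (fun y => 2 * (coord i y - coord i x))); last exact: ch1.
    by apply: continuousM; [exact: cvg_cst|exact: ccoord].
  apply: (@bounded_funP _ (2 * C)) => y.
  rewrite !normrM ger0_norm// -mulrA ler_pM2l//.
  apply: le_trans (h1C _ (sqdist_ge0 x y)).
  by rewrite ler_wpM2r// coord_norm_le.
- move=> i j; split; first by move=> y; case: (d2 i j y).
  rewrite p2; split.
    move=> y.
    apply: (@continuousD _ _ _ (fun y => 2 * (i == j)%:R * h1 (sqdist x y))).
      by apply: (@continuousM _ _ (cst _)); [exact: cvg_cst|exact: ch1].
    apply: (@continuousM _ _
      (fun y => 4 * (coord i y - coord i x) * (coord j y - coord j x)));
      last exact: ch2.
    apply: (@continuousM _ _ (fun y => 4 * (coord i y - coord i x))); last exact: ccoord.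
    by apply: continuousM; [exact: cvg_cst|exact: ccoord].
  apply: (@bounded_funP _ (6 * C)) => y.
  have q0 := sqdist_ge0 x y.
  have := h1C _ q0; have := h2C _ q0; have := coord_mul_le x i j y.
  rewrite -[4 * _ * _]mulrA => cij C2 C1.
  apply: le_trans (ler_normD _ _) _.
  rewrite 2!normrM [X in _ + X]normrM [`|4 * _|]normrM.
  rewrite (@ger0_norm _ 2)// (@ger0_norm _ 4)//.
  have dij : `|(i == j)%:R| <= 1 :> R by case: (i == j); rewrite ?normr1 ?normr0.
  have aux (a b c d q : R) : 0 <= a -> 0 <= b -> 0 <= c -> 0 <= d -> 0 <= q ->
      d <= 1 -> c <= q -> (1 + q) * a <= C -> (1 + q) * b <= C ->
      2 * d * a + 4 * c * b <= 6 * C.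
    move=> a0 b0 c0 d0 q0' d1' cq aC bC.
    have : d * a <= C by nra.
    have : c * b <= C by nra.
    lra.
  exact: (aux _ _ _ _ (sqdist x y)).
Qed.

End Radial.

(** * Truncated Frullani integrals *)
Section LaplaceTransform.
Context {R : realType}.
Implicit Types (n q v : R) (k : nat).

(** With [u = expR v], the function [u^k * expR (- u q)]: the change of variable
    turns the measure [du / u] of the Frullani integral into [dv] and keeps all
    integrands smooth on the whole line. *)
Definition lker k q v : R := expR v ^+ k * expR (- (expR v * q)).

Definition lint n k q : R :=
  \int[lebesgue_measure]_(v in `[- n, n]) lker k q v.

Lemma is_derive_lker_param k q v :
  is_derive q (1 : R) (lker k ^~ v) (- lker k.+1 q v).
Proof.
have h1 : is_derive q (1 : R) (fun q => - (expR v * q)) (- expR v).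
  by apply: is_derive_eq; rewrite [_%:A]mulr1.
have h2 := @is_derive1_comp R expR (fun q => - (expR v * q)) _ _ _
  (is_derive_expR _) h1.
apply: (is_derive_eq (is_deriveZ (expR v ^+ k) h2)).
by rewrite /GRing.scale/= /lker exprS; ring.
Qed.

Lemma is_derive_expNexp q v :
  is_derive v (1 : R) (fun v => expR (- (expR v * q))) (- (q * lker 1 q v)).
Proof.
have h1 : is_derive v (1 : R) (fun v => - (expR v * q)) (- (expR v * q)).
  by apply: is_derive_eq; rewrite /GRing.scale/=; ring.
have h2 := @is_derive1_comp R expR (fun v => - (expR v * q)) _ _ _
  (is_derive_expR _) h1.
by apply: (is_derive_eq h2); rewrite /lker; ring.
Qed.

Lemma is_derive_lker k q v :
  is_derive v (1 : R) (lker k q) (k%:R * lker k q v - q * lker k.+1 q v).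
Proof.
have h1 : is_derive v (1 : R) (fun v => expR v ^+ k) (k%:R * expR v ^+ k).
  rewrite (_ : (fun v => _) = expR \o (fun v : R => k%:R * v)); last first.
    by apply/funext => z /=; rewrite expRM_natl.
  rewrite -expRM_natl mulrC; apply: is_derive1_comp.
  by apply: is_derive_eq; rewrite [_%:A]mulr1.
apply: (is_derive_eq (is_deriveM h1 (is_derive_expNexp q v))).
by rewrite /GRing.scale/= /lker (exprS _ k) expr1; ring.
Qed.

Lemma is_derive_continuous (f : R -> R) x d :
  is_derive x (1 : R) f d -> {for x, continuous f}.
Proof. by case=> d1 _; apply/differentiable_continuous/derivable1_diffP. Qed.

Lemma continuous_lker k q : continuous (lker k q).
Proof. by move=> v; exact: is_derive_continuous (is_derive_lker k q v). Qed.

Lemma integrable_lker n k q :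
  lebesgue_measure.-integrable `[- n, n] (EFin \o lker k q).
Proof.
apply: continuous_compact_integrable; first exact: segment_compact.
exact/continuous_subspaceT/continuous_lker.
Qed.

Lemma is_derive_lint n k q : is_derive q (1 : R) (lint n k) (- lint n k.+1 q).
Proof.
have mI : measurable (`[- n, n]%classic : set (measurableTypeR R)).
  exact: measurable_itv.
(* This dominates the derivatives at all parameters within [1] of [q]. *)
pose G v := lker k.+1 (- (`|q| + 1)) v.
have Gi : lebesgue_measure.-integrable `[- n, n] (EFin \o G) by exact: integrable_lker.
have G0 v : 0 <= G v by rewrite mulr_ge0// ?exprn_ge0// expR_ge0.
have qI : `]q - 1, q + 1[%classic q by rewrite /= in_itv/=; lra.
have dk (p v : R) : derivable (lker k ^~ v) p 1 by case: (is_derive_lker_param k p v).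
have pE p v : partial1of2 (lker k) p v = - lker k.+1 p v.
  by rewrite partial1of2E; apply: derive_val; exact: is_derive_lker_param.
have Gub (p v : R) : `]q - 1, q + 1[%classic p -> `[- n, n]%classic v ->
    `|partial1of2 (lker k) p v| <= G v.
  rewrite /= in_itv/= => /andP[p1 p2] _.
  rewrite pE normrN ger0_norm; last by rewrite mulr_ge0// ?exprn_ge0// expR_ge0.
  rewrite ler_wpM2l ?exprn_ge0 ?expR_ge0// ler_expR mulrN opprK -mulrN.
  by rewrite ler_wpM2l ?expR_ge0//; have := ler_norm (- q); rewrite normrN; lra.
split.
  have := (derivable_under_integral mI qI
    (fun p _ => integrable_lker n k p) (fun p v _ _ => dk p v) G0 Gi Gub). exact.
rewrite -derive1E (differentiation_under_integral mI qI
    (fun p _ => integrable_lker n k p) (fun p v _ _ => dk p v) G0 Gi Gub).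
transitivity (\int[lebesgue_measure]_(v in `[- n, n]) (- 1 * lker k.+1 q v)).
  by apply: eq_Rintegral => v _; rewrite pE mulN1r.
by rewrite RintegralZl// ?mulN1r//; exact: integrable_lker.
Qed.

Lemma lint_ge0 n k q : 0 <= lint n k q.
Proof.
by apply: Rintegral_ge0 => v _; rewrite mulr_ge0// ?exprn_ge0// expR_ge0.
Qed.

Lemma lint_le n k q : 0 < n -> 0 <= q -> lint n k q <= 2 * n * expR n ^+ k.
Proof.
move=> n0 q0.
have -> : 2 * n * expR n ^+ k =
    \int[lebesgue_measure]_(v in `[- n, n]) (expR n ^+ k).
  have e : lebesgue_measure (`[- n, n]%classic : set R) = (2 * n)%:E.
    rewrite lebesgue_measure_itv/= lte_fin ifT; last lra.
    by rewrite -EFinD; congr (_%:E); ring.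
  rewrite Rintegral_cst// mulrC; congr (_ * _).
  exact: (congr1 fine (esym e)).
apply: le_Rintegral => //; first exact: integrable_lker.
  apply: continuous_compact_integrable; first exact: segment_compact.
  by apply: continuous_subspaceT => z; exact: cvg_cst.
move=> v; rewrite /= in_itv/= => /andP[_ vn].
rewrite -[leRHS]mulr1 ler_pM ?exprn_ge0 ?expR_ge0//.
  by rewrite lerXn2r ?nnegrE ?expR_ge0// ler_expR.
by rewrite -expR0 ler_expR oppr_le0 mulr_ge0 ?expR_ge0.
Qed.

Lemma Rint_FTC2 (f F : R -> R) a b : a < b -> continuous f ->
  (forall v, is_derive v (1 : R) F (f v)) ->
  \int[lebesgue_measure]_(v in `[a, b]) f v = F b - F a.
Proof.
move=> ab cf dF.
have cF : continuous F by move=> v; exact: is_derive_continuous (dF v).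
rewrite /Rintegral (continuous_FTC2 ab _ _ (F := F)) -?EFinB//.
- exact: continuous_subspaceT.
- split; first by move=> v _; case: (dF v).
  + exact/cvg_at_right_filter/cF.
  + exact/cvg_at_left_filter/cF.
- by move=> v _; rewrite derive1E; exact: derive_val.
Qed.

(** [q * lker 1 q] is a derivative in [v], up to sign, of
    [expR (- (expR v * q))]. *)
Lemma lint1E n q : 0 < n ->
  q * lint n 1 q = expR (- (expR (- n) * q)) - expR (- (expR n * q)).
Proof.
move=> n0; rewrite -RintegralZl//; last exact: integrable_lker.
have nn : - n < n by lra.
have c : continuous (fun v => q * lker 1 q v).
  by move=> v; apply: continuousM; [exact: cvg_cst|exact: continuous_lker].
have d v : is_derive v (1 : R) (fun v => - expR (- (expR v * q))) (q * lker 1 q v).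
  by rewrite -[q * _]opprK; apply: is_deriveN; exact: is_derive_expNexp.
by rewrite (Rint_FTC2 nn c d); ring.
Qed.

(** The integrand [lker 1 - q * lker 2] of half the Laplacian of the truncated
    logarithm is the derivative in [v] of [lker 1 q]: only the two ends of the
    interval contribute, a heat kernel and a small remainder. *)
Lemma lint2E n q : 0 < n ->
  lint n 1 q - q * lint n 2 q = lker 1 q n - lker 1 q (- n).
Proof.
move=> n0; rewrite -RintegralZl//; last exact: integrable_lker.
have nn : - n < n by lra.
have c2 : continuous (fun v => q * lker 2 q v).
  by move=> v; apply: continuousM; [exact: cvg_cst|exact: continuous_lker].
have c : continuous (fun v => lker 1 q v - q * lker 2 q v).
  by move=> v; apply: continuousB; [exact: continuous_lker|exact: c2].
rewrite -RintegralB//; [|exact: integrable_lker|]; last first.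
  apply: continuous_compact_integrable; first exact: segment_compact.
  exact: continuous_subspaceT.
have d v : is_derive v (1 : R) (lker 1 q) (lker 1 q v - q * lker 2 q v).
  by have := is_derive_lker 1 q v; rewrite mul1r.
by rewrite (Rint_FTC2 nn c d).
Qed.

End LaplaceTransform.

(** * Bounded approximations of the logarithm *)
Section LogProfile.
Context {R : realType}.
Implicit Types (n p q N dlt : R).

(** The Frullani integral of [(expR (- u) - expR (- u q)) / (2 u)] over
    [u] in [[expR (- n), expR n]]; over the half-line it equals [ln q / 2]. *)
Definition logprof n q : R := 2^-1 * (lint n 0 1 - lint n 0 q).

Lemma is_derive_logprof n q : is_derive q (1 : R) (logprof n) (2^-1 * lint n 1 q).
Proof.
have h := is_derive_lint n 0 q.
apply: (is_derive_eq (is_deriveZ 2^-1 (is_deriveB (is_derive_cst (lint n 0 1) q 1) h))).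
by rewrite sub0r opprK.
Qed.

Lemma lker_ge0 k q v : 0 <= lker k q v.
Proof. by rewrite mulr_ge0// ?exprn_ge0 ?expR_ge0. Qed.

Lemma lker_le k q v : 0 <= q -> lker k q v <= expR v ^+ k.
Proof.
move=> q0; rewrite -[leRHS]mulr1 ler_wpM2l ?exprn_ge0 ?expR_ge0//.
by rewrite expR_le1 oppr_le0 mulr_ge0 ?expR_ge0.
Qed.

Lemma expRN_le1 q : 0 <= q -> expR (- q) <= 1.
Proof. by move=> q0; rewrite expR_le1 oppr_le0. Qed.

(** Half the Laplacian of [log] is [pi] times the Dirac mass at [x]; here it is
    [pi] times the heat kernel at time [expR (- n) / 2], minus a remainder of
    size [expR (- n)]. *)
Lemma logprof_Cb2 (x : R * R) n : 0 < n -> Cb2 (logprof n \o sqdist x) /\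
  forall y, 2^-1 * laplacian (logprof n \o sqdist x) y =
            lker 1 (sqdist x y) n - lker 1 (sqdist x y) (- n).
Proof.
move=> n0.
have e1 : 1 <= expR n by rewrite -expR0 ler_expR ltW.
have eN1 : expR (- n) <= 1 by apply: expRN_le1; exact: ltW.
have l0 q : 0 <= q -> 0 <= lint n 0 q <= 2 * n.
  by move=> q0; rewrite lint_ge0; have := lint_le 0 n0 q0; rewrite expr0 mulr1.
have e2 : expR n <= expR n ^+ 2 by rewrite expr2; nra.
have l1 q : 0 <= q -> 0 <= lint n 1 q <= 2 * n * expR n ^+ 2.
  move=> q0; rewrite lint_ge0 (le_trans (lint_le 1 n0 q0))//.
  by rewrite expr1 ler_wpM2l//; lra.
have l2 q : 0 <= q -> 0 <= lint n 2 q <= 2 * n * expR n ^+ 2.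
  by move=> q0; rewrite lint_ge0 lint_le.
have K0 : 0 <= n * expR n ^+ 2 by rewrite mulr_ge0 ?sqr_ge0// ltW.
have nK : n <= n * expR n ^+ 2 by have := sqr_ge0 (expR n); nra.
have [|||||| cb2 lap] := @radial_Cb2 _ x (logprof n)
  (fun q => 2^-1 * lint n 1 q) (fun q => - (2^-1 * lint n 2 q))
  (2 * (n * expR n ^+ 2) + 1).
- by move=> q _; exact: is_derive_logprof.
- by move=> q _; rewrite -mulrN; apply: is_deriveZ; exact: is_derive_lint.
- move=> q _; apply/continuousN/continuousM; first exact: cvg_cst.
  exact: is_derive_continuous (is_derive_lint n 2 q).
- move=> q q0; rewrite /logprof ler_norml.
  by have := l0 _ q0; have := l0 _ (@ler01 R); lra.
- move=> q q0; rewrite ger0_norm ?mulr_ge0 ?lint_ge0// mulrCA mulrDl mul1r lint1E//.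
  have := expRN_le1 (mulr_ge0 (expR_ge0 (- n)) q0).
  by have := expR_ge0 (- (expR n * q)); have := l1 _ q0; lra.
- move=> q q0; rewrite normrN ger0_norm ?mulr_ge0 ?lint_ge0// mulrCA mulrDl mul1r.
  have := lint2E q n0; have := lker_ge0 1 q n; have := lker_le 1 (- n) q0.
  by rewrite expr1; have := l2 _ q0; have := l1 _ q0; lra.
split=> // y; rewrite lap -lint2E//; by field.
Qed.

Lemma logprof1 n : logprof n 1 = 0.
Proof. by rewrite /logprof subrr mulr0. Qed.

Lemma logprof_homo n p q : p <= q -> logprof n p <= logprof n q.
Proof.
move=> pq; rewrite /logprof ler_wpM2l// lerD2l lerN2.
apply: le_Rintegral => //; [exact: integrable_lker|exact: integrable_lker|].
move=> v _; rewrite ler_wpM2l ?exprn_ge0 ?expR_ge0// ler_expR lerN2.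
by rewrite ler_wpM2l ?expR_ge0.
Qed.

(** The derivative of [ln q / 2 - logprof n q] is
    [(1 - expR (- (expR (- n) * q)) + expR (- (expR n * q))) / (2 q)]: it is
    nonnegative, and [1 - expR (- z) <= z] and [expR (- z) <= 1 / z] bound it.
    The mean value theorem gives both inequalities, hence domination by the
    logarithm and convergence to it. *)
Lemma logprof_ln_incr n p q : 0 < n -> 0 < p -> p <= q ->
  0 <= (2^-1 * ln q - logprof n q) - (2^-1 * ln p - logprof n p)
    <= expR (- n) * (1 + p^-1 ^+ 2) * (q - p).
Proof.
move=> n0 p0; rewrite le_eqVlt => /predU1P[<-|pq].
  by rewrite !subrr mulr0 lexx.
have d (c : R) : 0 < c -> is_derive c (1 : R) (fun q => 2^-1 * ln q - logprof n q)
    (2^-1 * c^-1 - 2^-1 * lint n 1 c).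
  move=> c0; have h1 := is_derive_logprof n c; have h2 := is_derive1_ln c0.
  exact: is_deriveB (is_deriveZ _ h2) h1.
have [||c] := @MVT R (fun q => 2^-1 * ln q - logprof n q)
    (fun c => 2^-1 * c^-1 - 2^-1 * lint n 1 c) p q pq.
- by move=> c; rewrite in_itv/= => /andP[pc _]; apply: d; exact: lt_trans pc.
- apply: derivable_within_continuous => c.
  by rewrite in_itv/= => /andP[pc _]; case: (d c (lt_le_trans p0 pc)).
rewrite in_itv/= => /andP[pc cq] ->{d}.
have c0 : 0 < c by exact: lt_trans pc.
have qp0 : 0 <= q - p by rewrite subr_ge0 ltW.
suff : 0 <= 2^-1 * c^-1 - 2^-1 * lint n 1 c <= expR (- n) * (1 + p^-1 ^+ 2).
  by move=> /andP[? ?]; rewrite mulr_ge0//= ler_wpM2r.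
have -> : lint n 1 c = c^-1 * (expR (- (expR (- n) * c)) - expR (- (expR n * c))).
  by rewrite -lint1E// mulrA mulVf ?mul1r// gt_eqF.
have ci0 : 0 < c^-1 by rewrite invr_gt0.
have cp : c^-1 <= p^-1 by rewrite lef_pV2// ltW.
have eN0 := expR_gt0 (- n).
have e1 := expRN_le1 (mulr_ge0 (expR_ge0 (- n)) (ltW c0)).
have e2 : 1 - expR (- n) * c <= expR (- (expR (- n) * c)).
  by have := expR_ge1Dx (- (expR (- n) * c)).
have e3 : expR (- (expR n * c)) <= expR (- n) * c^-1.
  rewrite 2!expRN -invfM lef_pV2 ?posrE ?mulr_gt0 ?expR_gt0//.
  by have := expR_ge1Dx (expR n * c); lra.
have e3' := expR_ge0 (- (expR n * c)).
have cc : c^-1 * c = 1 by rewrite mulVf// gt_eqF.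
have f1 : c^-1 * (1 - expR (- (expR (- n) * c))) <= expR (- n).
  have : c^-1 * (1 - expR (- (expR (- n) * c))) <= c^-1 * (expR (- n) * c).
    by rewrite (ler_wpM2l (ltW ci0))//; lra.
  by rewrite mulrCA cc mulr1.
have f2 : c^-1 * expR (- (expR n * c)) <= expR (- n) * p^-1 ^+ 2.
  have : c^-1 * expR (- (expR n * c)) <= c^-1 * (expR (- n) * c^-1).
    by rewrite (ler_wpM2l (ltW ci0)).
  move=> /le_trans; apply; rewrite mulrCA (ler_wpM2l (ltW eN0))// expr2.
  by rewrite ler_pM// (ltW ci0).
have f3 : 0 <= c^-1 * (1 - expR (- (expR (- n) * c))).
  by rewrite (mulr_ge0 (ltW ci0))//; lra.
have f4 : 0 <= c^-1 * expR (- (expR n * c)) by rewrite (mulr_ge0 (ltW ci0)).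
lra.
Qed.

Lemma logprof_bound n q : 0 < n -> 0 < q -> `|logprof n q| <= `|2^-1 * ln q|.
Proof.
move=> n0 q0; have [q1|q1] := leP 1 q.
- have /andP[+ _] := logprof_ln_incr n0 ltr01 q1.
  have := logprof_homo n q1; rewrite logprof1 ln1 => l0.
  by move=> h; rewrite ger0_norm// ger0_norm; lra.
- have /andP[+ _] := logprof_ln_incr n0 q0 (ltW q1).
  have := logprof_homo n (ltW q1); rewrite logprof1 ln1 => l0.
  by move=> h; rewrite ler0_norm// ler0_norm; lra.
Qed.

Lemma logprof_cvg q : 0 < q -> logprof n.+1%:R q @[n --> \oo] --> 2^-1 * ln q.
Proof.
move=> q0.
(* Integrate [logprof_ln_incr] between [1] and [q], on either side. *)
pose K := (2 + q^-1 ^+ 2) * `|q - 1|.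
have ecvg : expR (- n.+1%:R) @[n --> \oo] --> (0 : R).
  by have := @cvgn_expR R; rewrite -cvg_shiftS.
have eK : expR (- n.+1%:R) * K @[n --> \oo] --> (0 : R).
  by rewrite -[X in _ --> X](mul0r K); apply: cvgM => //; exact: cvg_cst.
have cl : 2^-1 * ln q - expR (- n.+1%:R) * K @[n --> \oo] --> 2^-1 * ln q.
  by rewrite -[X in _ --> X]subr0; apply: cvgB => //; exact: cvg_cst.
have cu : 2^-1 * ln q + expR (- n.+1%:R) * K @[n --> \oo] --> 2^-1 * ln q.
  by rewrite -[X in _ --> X]addr0; apply: cvgD => //; exact: cvg_cst.
apply: squeeze_cvgr cl cu.
apply: nearW => n; have n0 : 0 < n.+1%:R :> R by [].
have q2 : 0 <= q^-1 ^+ 2 by exact: sqr_ge0.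
have en := expR_gt0 (- n.+1%:R : R).
have [q1|q1] := leP 1 q.
- have := logprof_ln_incr n0 ltr01 q1; rewrite logprof1 ln1 invr1 expr1n mulr0 !subr0.
  move=> /andP[h1 h2].
  have : expR (- n.+1%:R) * (1 + 1) * (q - 1) <= expR (- n.+1%:R) * K.
    rewrite -mulrA ler_pM2l// /K ger0_norm ?subr_ge0// ler_wpM2r ?subr_ge0//.
    lra.
  lra.
- have := logprof_ln_incr n0 q0 (ltW q1); rewrite logprof1 ln1 mulr0 subr0 sub0r.
  move=> /andP[h1 h2].
  have : expR (- n.+1%:R) * (1 + q^-1 ^+ 2) * (1 - q) <= expR (- n.+1%:R) * K.
    rewrite -mulrA ler_pM2l// /K ler0_norm ?subr_le0 ?(ltW q1)// opprB.
    rewrite ler_wpM2r ?subr_ge0 ?(ltW q1)//.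
    lra.
  lra.
Qed.

(** By monotonicity [logprof n 0 <= logprof n p] for every [p > 0], and the
    latter tends to [ln p / 2], which is arbitrarily negative. *)
Lemma logprof0_cvg (A : R) : \forall n \near \oo, A <= `|logprof n.+1%:R (0 : R)|.
Proof.
(* Chosen so that [ln p / 2 < - |A|]. *)
pose p : R := expR (- (2 * (`|A| + 1))).
have p0 : 0 < p by exact: expR_gt0.
have lp : 2^-1 * ln p = - (`|A| + 1) by rewrite expRK; field.
have /cvgr_lt : 2^-1 * ln p < - `|A| by rewrite lp; lra.
move=> /(_ _ _ _ _ (logprof_cvg p0)).
apply: filterS => n h; have := logprof_homo n.+1%:R (ltW p0) => h2.
by rewrite ler0_norm; have := ler_norm A; have := normr_ge0 A; lra.
Qed.

End LogProfile.

(** * Profiles controlling second moments and logarithmic singularities *)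
Section MomentProfiles.
Context {R : realType}.
Implicit Types (p q N : R).

(** This is [N q / (N + q)]: bounded, increasing to [q] with [N], and with half
    Laplacian at most [2], as for [q] itself. *)
Definition momprof N q : R := N - N ^+ 2 * (N + q)^-1.

Lemma is_derive_invS N q (k : nat) : 0 < N + q ->
  is_derive q (1 : R) (fun q => ((N + q)^-1) ^+ k.+1)
    (- k.+1%:R * ((N + q)^-1) ^+ k.+2).
Proof.
move=> Nq; have Nq0 : N + q != 0 by rewrite gt_eqF.
have h0 : is_derive q (1 : R) (fun q => N + q) 1.
  by apply: is_derive_eq; rewrite add0r mulr1.
have h1 := is_deriveV Nq0 h0.
have {}h1 : is_derive q (1 : R) (fun q => (N + q)^-1) (- (N + q)^-1 ^+ 2).
  by apply: (is_derive_eq h1); rewrite exprVn [LHS]mulr1.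
elim: k => [|k IH]; first by apply: (is_derive_eq h1); rewrite mulN1r.
rewrite (_ : (fun q => _) = (fun q => (N + q)^-1 * (N + q)^-1 ^+ k.+1)); last first.
  by apply/funext => z; rewrite exprS.
apply: (is_derive_eq (is_deriveM h1 IH)); rewrite /GRing.scale/=.
by rewrite (exprS _ k.+2) (exprS _ k.+1) (exprS _ k) (natrD _ 1 k.+1) expr2; ring.
Qed.

Lemma momprof_Cb2 (x : R * R) N : 1 <= N -> Cb2 (momprof N \o sqdist x) /\
  forall y, 2^-1 * laplacian (momprof N \o sqdist x) y <= 2.
Proof.
move=> N1; have Nq q : 0 <= q -> 0 < N + q by lra.
have Nq1 q : 0 <= q -> (N + q)^-1 * (N + q) = 1.
  by move=> q0; rewrite mulVf// gt_eqF ?Nq.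
have i0 q : 0 <= q -> 0 < (N + q)^-1 by move=> q0; rewrite invr_gt0 Nq.
have Ni q : 0 <= q -> N * (N + q)^-1 <= 1.
  by move=> q0; rewrite ler_pdivrMr ?Nq//; lra.
have qi q : 0 <= q -> (1 + q) * (N + q)^-1 <= 1.
  by move=> q0; rewrite ler_pdivrMr ?Nq//; lra.
have [||||||cb2 lap] := @radial_Cb2 _ x (momprof N)
  (fun q => N ^+ 2 * ((N + q)^-1) ^+ 2) (fun q => - (2 * N ^+ 2) * ((N + q)^-1) ^+ 3) (2 * N).
- move=> q q0; have h := is_derive_invS 0 (Nq q q0); have {h} := is_deriveZ (N ^+ 2) h.
  move=> h; apply: (is_derive_eq (is_deriveB (is_derive_cst N q 1) h)).
  rewrite /GRing.scale/=; ring.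
- move=> q q0; have h := is_derive_invS 1 (Nq q q0); have {h} := is_deriveZ (N ^+ 2) h.
  move=> h; apply: (is_derive_eq h); rewrite /GRing.scale/=; ring.
- move=> q q0; apply: continuousM; first exact: cvg_cst.
  exact: is_derive_continuous (is_derive_invS 2 (Nq q q0)).
- move=> q q0; rewrite /momprof expr2 -mulrA ler_norml.
  by have := Ni q q0; have := i0 q q0; nra.
- move=> q q0; rewrite ger0_norm; last first.
    by apply: mulr_ge0; exact: sqr_ge0.
  rewrite [X in X <= _](_ : _ = (N * (N + q)^-1) * ((1 + q) * (N + q)^-1) * N); last ring.
  have := Ni q q0; have := i0 q q0; have := qi q q0.
  have : 0 <= N * (N + q)^-1 by apply: mulr_ge0; [lra|rewrite (ltW (i0 _ q0))].
  have : 0 <= (1 + q) * (N + q)^-1 by apply: mulr_ge0; [lra|rewrite (ltW (i0 _ q0))].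
  move: (N * _) ((1 + q) * _) => a b *.
  have : a * b <= 1 by nra.
  nra.
- move=> q q0; rewrite mulNr normrN ger0_norm; last first.
    apply: mulr_ge0; first by apply: mulr_ge0 => //; exact: sqr_ge0.
    by apply: exprn_ge0; rewrite ltW// i0.
  rewrite [X in X <= _](_ : _ = 2 * ((N * (N + q)^-1) ^+ 2 * ((1 + q) * (N + q)^-1))); last ring.
  have := Ni q q0; have := i0 q q0; have := qi q q0.
  have : 0 <= N * (N + q)^-1 by apply: mulr_ge0; [lra|rewrite (ltW (i0 _ q0))].
  have : 0 <= (1 + q) * (N + q)^-1 by apply: mulr_ge0; [lra|rewrite (ltW (i0 _ q0))].
  move: (N * _) ((1 + q) * _) => a b *.
  have : a ^+ 2 <= 1 by rewrite expr2; nra.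
  have : 0 <= a ^+ 2 by exact: sqr_ge0.
  have : 0 <= b by [].
  move: (a ^+ 2) => c *; have : c * b <= 1 by nra.
  nra.
split=> // y; rewrite lap; have q0 := sqdist_ge0 x y.
move: (sqdist x y) q0 => q q0.
rewrite [X in X <= _](_ : _ = 2 * ((N * (N + q)^-1) ^+ 2 * (1 - 2 * (q * (N + q)^-1)))); last ring.
have := Ni q q0; have := i0 q q0.
have : 0 <= N * (N + q)^-1 by apply: mulr_ge0; [lra|rewrite (ltW (i0 _ q0))].
have : 0 <= q * (N + q)^-1 by apply: mulr_ge0; [lra|rewrite (ltW (i0 _ q0))].
move: (N * _) (q * _) => a b *.
have : a ^+ 2 <= 1 by rewrite expr2; nra.
have : 0 <= a ^+ 2 by exact: sqr_ge0.
move: (a ^+ 2) => c *; nra.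
Qed.

Lemma momprofE N q : 0 < N -> 0 <= q -> momprof N q = q - q ^+ 2 * (N + q)^-1.
Proof. by move=> N0 q0; rewrite /momprof; field; rewrite gt_eqF; lra. Qed.

Lemma momprof_ge0 N q : 0 < N -> 0 <= q -> 0 <= momprof N q.
Proof.
move=> N0 q0; rewrite /momprof expr2 -mulrA.
have : N * (N + q)^-1 <= 1 by rewrite ler_pdivrMr; lra.
nra.
Qed.

Lemma momprof_le N q : 0 < N -> 0 <= q -> momprof N q <= q.
Proof.
move=> N0 q0; rewrite momprofE// gerBl mulr_ge0 ?sqr_ge0// invr_ge0; lra.
Qed.

Lemma momprof_cvg q : 0 <= q -> momprof n.+1%:R q @[n --> \oo] --> q.
Proof.
move=> q0.
have ei : (n.+1%:R)^-1 @[n --> \oo] --> (0 : R) by exact: cvg_harmonic.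
have cl : q - q ^+ 2 * (n.+1%:R)^-1 @[n --> \oo] --> q.
  rewrite -[X in _ --> X]subr0 -[X in _ --> _ - X](mulr0 (q ^+ 2)).
  by apply: cvgB; [exact: cvg_cst|apply: cvgM => //; exact: cvg_cst].
have cu : (q : R) @[n --> \oo] --> q by exact: cvg_cst.
apply: squeeze_cvgr cl cu.
apply: nearW => n; rewrite momprof_le// andbT momprofE// lerD2l lerN2.
rewrite ler_wpM2l ?sqr_ge0// lef_pV2 ?posrE ?lerDl//.
by rewrite ltr_pwDl.
Qed.

(** In dimension two [1 / r] is the Laplacian of [r]. It is integrable
    near the origin yet dominates every power of the logarithm; the cubic factor
    comes out of the computation for the bounded function [- 1 / (1 + r)]. *)
Definition sing (s : R) : R := (s * (1 + s) ^+ 3)^-1.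

(** The function [- 1 / (1 + r)] with [r] smoothed into [sqrt (q + dlt)]. *)
Definition sqprof (dlt q : R) : R := - (1 + Num.sqrt (q + dlt))^-1.

Lemma is_derive_sqrtD dlt q : 0 < q + dlt ->
  is_derive q (1 : R) (fun q => Num.sqrt (q + dlt)) ((2 * Num.sqrt (q + dlt))^-1).
Proof.
move=> q0; have h0 : is_derive q (1 : R) (fun q => q + dlt) 1.
  by apply: is_derive_eq; rewrite addr0.
rewrite -[_^-1]mulr1.
exact: (@is_derive1_comp R Num.sqrt (fun q => q + dlt) _ _ _ (is_derive1_sqrt q0) h0).
Qed.

Lemma is_derive_sqprof dlt q : 0 < q + dlt ->
  let s := Num.sqrt (q + dlt) in
  is_derive q (1 : R) (sqprof dlt) ((2 * s * (1 + s) ^+ 2)^-1).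
Proof.
move=> q0 s; have s0 : 0 < s by rewrite sqrtr_gt0.
have h1 := is_derive_sqrtD q0.
have h2 : is_derive q (1 : R) (fun q => 1 + Num.sqrt (q + dlt)) ((2 * s)^-1).
  by apply: (is_derive_eq (is_deriveD (is_derive_cst (1 : R) q 1) h1)); rewrite add0r.
have s1 : 1 + Num.sqrt (q + dlt) != 0 by rewrite gt_eqF// addr_gt0// sqrtr_gt0.
rewrite (_ : sqprof dlt = - (fun q => (1 + Num.sqrt (q + dlt))^-1))//.
apply: (is_derive_eq (is_deriveN (@is_deriveV R (fun q => 1 + Num.sqrt (q + dlt)) _ _ _ s1 h2))).
by rewrite /GRing.scale/= -/s; field; rewrite !gt_eqF//; lra.
Qed.

Lemma is_derive_sqprof1 dlt q : 0 < q + dlt ->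
  let s := Num.sqrt (q + dlt) in
  is_derive q (1 : R) (fun q => (2 * Num.sqrt (q + dlt) * (1 + Num.sqrt (q + dlt)) ^+ 2)^-1)
    (- (1 + 3 * s) / (4 * s ^+ 3 * (1 + s) ^+ 3)).
Proof.
move=> q0 s; have s0 : 0 < s by rewrite sqrtr_gt0.
have h1 := is_derive_sqrtD q0.
have h2 : is_derive q (1 : R) (fun q => 1 + Num.sqrt (q + dlt)) ((2 * s)^-1).
  by apply: (is_derive_eq (is_deriveD (is_derive_cst (1 : R) q 1) h1)); rewrite add0r.
have h3 := is_deriveM (is_deriveZ 2 h1) (is_deriveM h2 h2).
have s1 : 2 * Num.sqrt (q + dlt) * (1 + Num.sqrt (q + dlt)) ^+ 2 != 0.
  by rewrite -/s gt_eqF// mulr_gt0 ?mulr_gt0 ?exprn_gt0//; lra.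
apply: (is_derive_eq (@is_deriveV R
  (fun q => 2 * Num.sqrt (q + dlt) * (1 + Num.sqrt (q + dlt)) ^+ 2) _ _ _ s1 h3)).
rewrite [X in _ *: X](_ : _ = 2 * s * ((1 + s) / (2 * s) + (1 + s) / (2 * s))
  + (1 + s) * (1 + s) * (2 / (2 * s)))// /GRing.scale/= -/s.
by field; rewrite !gt_eqF//; lra.
Qed.

Lemma sqprof_Cb2 (x : R * R) dlt : 0 < dlt -> Cb2 (sqprof dlt \o sqdist x) /\
  forall y, 2^-1 * sing (Num.sqrt (sqdist x y + dlt)) - 2^-1
     <= 2^-1 * laplacian (sqprof dlt \o sqdist x) y.
Proof.
move=> d0; have qd q : 0 <= q -> 0 < q + dlt by lra.
have s0 q : 0 <= q -> 0 < Num.sqrt (q + dlt) by move=> q0; rewrite sqrtr_gt0 qd.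
have ss q : 0 <= q -> Num.sqrt (q + dlt) ^+ 2 = q + dlt.
  by move=> q0; rewrite sqr_sqrtr// ltW// qd.
pose d := Num.sqrt dlt; have dd : d ^+ 2 = dlt by rewrite sqr_sqrtr// ltW.
have dp : 0 < d by rewrite sqrtr_gt0.
have ds q : 0 <= q -> d <= Num.sqrt (q + dlt) by move=> q0; rewrite ler_sqrt ?qd//; lra.
have [||||||cb2 lap] := @radial_Cb2 _ x (sqprof dlt)
  (fun q => (2 * Num.sqrt (q + dlt) * (1 + Num.sqrt (q + dlt)) ^+ 2)^-1)
  (fun q => let s := Num.sqrt (q + dlt) in - (1 + 3 * s) / (4 * s ^+ 3 * (1 + s) ^+ 3))
  (1 + d^-1 + (d ^+ 3)^-1).
- by move=> q q0; exact: is_derive_sqprof (qd q q0).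
- by move=> q q0; exact: is_derive_sqprof1 (qd q q0).
- move=> q q0 /=.
  have cs : {for q, continuous (fun q => Num.sqrt (q + dlt))}.
    exact: is_derive_continuous (is_derive_sqrtD (qd q q0)).
  have ck (s : R) : 0 < s ->
      {for s, continuous (fun s : R => - (1 + 3 * s) / (4 * s ^+ 3 * (1 + s) ^+ 3))}.
    move=> sp.
    have c0 : {for s, continuous (fun s : R => s)} by exact: cvg_id.
    have c1 : {for s, continuous (fun s : R => 1 + s)}.
      by apply: continuousD; [exact: cvg_cst|exact: c0].
    have c3 (a : R) (f : R -> R) : {for s, continuous f} ->
        {for s, continuous (fun s : R => a * f s)}.
      by move=> cf; apply: continuousM => //; exact: cvg_cst.
    have cX (f : R -> R) : {for s, continuous f} ->
        {for s, continuous (fun s : R => f s ^+ 3)}.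
      move=> cf; apply: (@continuous_comp _ _ _ f (fun x => x ^+ 3)) => //.
      exact: exprn_continuous.
    have c13 : {for s, continuous (fun s : R => 1 + 3 * s)}.
      by apply: continuousD; [exact: cvg_cst|exact: c3].
    apply: continuousM; first exact: (continuousN c13).
    apply: continuousV; first by rewrite gt_eqF// !mulr_gt0 ?exprn_gt0//; lra.
    by apply: continuousM; [exact/c3/cX|exact: cX].
  apply: (@continuous_comp _ _ _ (fun q => Num.sqrt (q + dlt))
    (fun s => - (1 + 3 * s) / (4 * s ^+ 3 * (1 + s) ^+ 3))) => //.
  exact/ck/s0.
- move=> q q0; rewrite /sqprof normrN ger0_norm ?invr_ge0; last by have := s0 _ q0; lra.
  have : (1 + Num.sqrt (q + dlt))^-1 <= 1 by rewrite invf_le1; have := s0 _ q0; lra.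
  have : 0 < d^-1 by rewrite invr_gt0.
  have : 0 < (d ^+ 3)^-1 by rewrite invr_gt0 exprn_gt0.
  lra.
- move=> q q0; have := s0 _ q0; have := ds _ q0; have := ss _ q0.
  move: (Num.sqrt _) => s sq dls sp.
  have dv : s^-1 <= d^-1 by rewrite lef_pV2.
  have : 0 < (d ^+ 3)^-1 by rewrite invr_gt0 exprn_gt0.
  suff : (1 + q) * `|(2 * s * (1 + s) ^+ 2)^-1| <= s^-1 by lra.
  rewrite ger0_norm; last by rewrite invr_ge0 !mulr_ge0 ?sqr_ge0//; lra.
  rewrite [X in X <= _](_ : _ = (1 + q) * (1 + s)^-1 ^+ 2 * (2^-1 * s^-1)); last first.
    by field; rewrite !gt_eqF//; lra.
  have : (1 + q) * (1 + s)^-1 ^+ 2 <= 1.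
    by rewrite exprVn ler_pdivrMr ?exprn_gt0//; nra.
  have : 0 < s^-1 by rewrite invr_gt0.
  have : 0 <= (1 + q) * (1 + s)^-1 ^+ 2 by rewrite mulr_ge0 ?sqr_ge0//; lra.
  move: (_ * _ ^+ 2) => a; nra.
- move=> q q0; have := s0 _ q0; have := ds _ q0; have := ss _ q0.
  move: (Num.sqrt _) => s sq dls sp /=.
  have dv : (s ^+ 3)^-1 <= (d ^+ 3)^-1.
    by rewrite lef_pV2 ?posrE ?exprn_gt0// lerXn2r ?nnegrE ?(ltW sp) ?(ltW dp).
  have : 0 < d^-1 by rewrite invr_gt0.
  suff : (1 + q) * `|- (1 + 3 * s) / (4 * s ^+ 3 * (1 + s) ^+ 3)| <= (s ^+ 3)^-1 by lra.
  have s3 : 0 < (s ^+ 3)^-1 by rewrite invr_gt0 exprn_gt0.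
  rewrite mulNr normrN ger0_norm; last first.
    by rewrite mulr_ge0 ?invr_ge0 ?mulr_ge0 ?exprn_ge0//; lra.
  rewrite [X in X <= _](_ : _ = ((1 + q) * (1 + s)^-1 ^+ 2) *
      (((1 + 3 * s) * (1 + s)^-1) * (4^-1 * (s ^+ 3)^-1))); last first.
    by field; rewrite !gt_eqF//; lra.
  have : (1 + q) * (1 + s)^-1 ^+ 2 <= 1.
    by rewrite exprVn ler_pdivrMr ?exprn_gt0//; nra.
  have : (1 + 3 * s) * (1 + s)^-1 <= 3.
    by rewrite ler_pdivrMr; lra.
  have : 0 <= (1 + q) * (1 + s)^-1 ^+ 2 by rewrite mulr_ge0 ?sqr_ge0//; lra.
  have : 0 <= (1 + 3 * s) * (1 + s)^-1 by rewrite mulr_ge0 ?invr_ge0//; lra.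
  move: s3; move: (_ * _ ^+ 2) (_ * (1 + s)^-1) (_ ^-1) => a b c c0 b0 a0 b3 a1.
  have : 0 <= b * (4^-1 * c) by rewrite !mulr_ge0// ltW.
  have : b * (4^-1 * c) <= c by nra.
  move: (b * _) => e; nra.
split=> // y; rewrite lap; have q0 := sqdist_ge0 x y.
have := s0 _ q0; have := ss _ q0; move: (Num.sqrt _) => s;
  rewrite /= /sing => sq sp.
pose u := (1 + s)^-1; pose v := s^-1.
have u0 : 0 < u by rewrite invr_gt0; lra.
have u1 : u <= 1 by rewrite invf_le1; lra.
have v0 : 0 < v by rewrite invr_gt0.
have k0 : 0 <= (1 + 3 * s) / (4 * s ^+ 3 * (1 + s) ^+ 3).
  by rewrite mulr_ge0 ?invr_ge0 ?mulr_ge0 ?exprn_ge0//; lra.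
have e : 2 * ((2 * s * (1 + s) ^+ 2)^-1 - s ^+ 2 * ((1 + 3 * s) / (4 * s ^+ 3 * (1 + s) ^+ 3)))
   = 2^-1 * (s * (1 + s) ^+ 3)^-1 - 2^-1 * u ^+ 3.
  by rewrite /u; field; rewrite !gt_eqF//; lra.
have u3 : u ^+ 3 <= 1 by rewrite exprn_ile1// ltW.
rewrite mulNr mulrN; move: e k0; move: (_ / _) (_^-1) (_^-1) => a b c e a0.
by rewrite sq in e; nra.
Qed.

Lemma sqprof_range dlt q : 0 <= q -> 0 < dlt -> -1 <= sqprof dlt q <= 0.
Proof.
move=> q0 d0; rewrite /sqprof oppr_le0 lerN2 invr_ge0.
have s0 := sqrtr_ge0 (q + dlt).
by apply/andP; split; [rewrite invf_le1; lra|lra].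
Qed.

Lemma sing_gt0 s : 0 < s -> 0 < sing s.
Proof. by move=> s0; rewrite invr_gt0 mulr_gt0// exprn_gt0// addr_gt0. Qed.

(** For [r = sqrt q < 1], [- ln r = 2 ln t <= 2 t] with [t = r^(-1/2)], so
    [ln^2 r <= 4 / r]; for [r >= 1], [ln r <= r]. *)
Lemma ln_sqr_le_sing q : 0 < q ->
  (2^-1 * ln q) ^+ 2 <= 32 * sing (Num.sqrt q) + q.
Proof.
move=> q0; have r0 : 0 < Num.sqrt q by rewrite sqrtr_gt0.
have qr : q = Num.sqrt q ^+ 2 by rewrite sqr_sqrtr// ltW.
have lnle (t : R) : 0 < t -> ln t <= t.
  move=> t0; have : ln (1 + (t - 1)) <= t - 1 by apply: le_ln1Dx; lra.
  by rewrite [1 + _]addrC subrK; lra.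
have sg := sing_gt0 r0.
have -> : 2^-1 * ln q = ln (Num.sqrt q) by rewrite {1}qr lnXn// -mulr_natl; field.
rewrite {3}qr; move: (Num.sqrt q) r0 sg {qr} => r r0 sg.
have [r1|r1] := leP 1 r.
  have := lnle _ r0; have := ln_ge0 r1 => l0 lr.
  have : ln r ^+ 2 <= r ^+ 2 by rewrite lerXn2r ?nnegrE// ltW.
  lra.
pose t := Num.sqrt (r^-1); have ri : 0 < r^-1 by rewrite invr_gt0.
have t0 : 0 < t by rewrite sqrtr_gt0.
have tr : t ^+ 2 = r^-1 by rewrite sqr_sqrtr// ltW.
have e : ln r = - (2 * ln t).
  by rewrite -[r]invrK -tr lnV ?posrE ?exprn_gt0// lnXn// mulr_natl.
have lt0 : 0 <= ln t.
  by have := ln_le0 (ltW r1); lra.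
have : ln t ^+ 2 <= t ^+ 2 by rewrite lerXn2r ?nnegrE ?lnle// ltW.
have : r^-1 <= 8 * sing r.
  rewrite /sing invfM mulrCA; have r1p : 0 < 1 + r by lra.
  have : 1 <= 8 * ((1 + r) ^+ 3)^-1.
    rewrite ler_pdivlMr ?exprn_gt0// mul1r.
    have : (1 + r) ^+ 3 <= 2 ^+ 3 by rewrite lerXn2r ?nnegrE; lra.
    lra.
  nra.
rewrite e sqrrN exprMn tr; have := sqr_ge0 r; lra.
Qed.

(** The choice [dlt = 1 / (n + 1)^2] makes [sqrt dlt] explicit at the
    singular point. *)
Definition smallsq (n : nat) : R := n.+1%:R^-1 ^+ 2.

Lemma smallsq_gt0 n : 0 < smallsq n.
Proof. by rewrite exprn_gt0// invr_gt0. Qed.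

Lemma sing_cvg q : 0 < q -> sing (Num.sqrt (q + smallsq n)) @[n --> \oo] --> sing (Num.sqrt q).
Proof.
move=> q0.
have ei : (n.+1%:R)^-1 @[n --> \oo] --> (0 : R) by exact: cvg_harmonic.
have e2 : q + smallsq n @[n --> \oo] --> q.
  rewrite -[X in _ --> X]addr0 -[X in _ --> _ + X](mulr0 0).
  by apply: cvgD; [exact: cvg_cst|exact: cvgM].
have es : Num.sqrt (q + smallsq n) @[n --> \oo] --> Num.sqrt q.
  by apply: continuous_cvg e2; exact: sqrt_continuous.
have r0 : 0 < Num.sqrt q by rewrite sqrtr_gt0.
apply: cvgV; first by rewrite gt_eqF// mulr_gt0// exprn_gt0// addr_gt0.
apply: cvgM => //.
have e1 : 1 + Num.sqrt (q + smallsq n) @[n --> \oo] --> 1 + Num.sqrt q.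
  by apply: cvgD => //; exact: cvg_cst.
by apply: cvgM => //; apply: cvgM.
Qed.

Lemma sing0_cvg (A : R) : \forall n \near \oo, A <= sing (Num.sqrt (0 + smallsq n)).
Proof.
near=> n.
rewrite add0r sqrtr_sqr ger0_norm//.
have nA : 8 * A <= n.+1%:R.
  rewrite (@le_trans _ _ n%:R) ?ler_nat//; near: n; exact: nbhs_infty_ger.
have i1 : n.+1%:R^-1 <= 1 :> R by rewrite invf_le1 ?ler1n.
have i0 : 0 < n.+1%:R^-1 :> R by rewrite invr_gt0.
rewrite /sing invfM invrK ler_pdivlMr; last by rewrite exprn_gt0// addr_gt0.
have [A0|A0] := leP 0 A.
  have : (1 + n.+1%:R^-1) ^+ 3 <= 2 ^+ 3 :> R.
    by move: i0 i1; move: (_^-1) => i i0 i1; rewrite lerXn2r ?nnegrE; lra.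
  move=> h; apply: le_trans nA; rewrite [leRHS]mulrC ler_wpM2l//; apply: le_trans h _; lra.
by apply: (@le_trans _ _ 0) => //; rewrite mulr_le0_ge0 ?exprn_ge0 ?ltW// ltr_wpDl// ltW.
Unshelve. all: by end_near. Qed.

End MomentProfiles.

(** * Comparison and Fatou lemmas *)
(** The bound [f + B] may be negative; moving the negative part of [f] to the
    left reduces the claim to nonnegative functions, and [B] may have infinite
    integral. *)
Lemma le_integral_shift d (T : measurableType d) (R : realType)
    (m : {measure set T -> \bar R}) (D : set T) (A B : T -> \bar R) (f : T -> R) :
  measurable D ->
  (forall x, D x -> 0 <= A x)%E -> (forall x, D x -> 0 <= B x)%E ->
  measurable_fun D A -> measurable_fun D B -> m.-integrable D (EFin \o f) ->
  {ae m, forall x, D x -> (A x <= (f x)%:E + B x)%E} ->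
  (\int[m]_(x in D) A x <= \int[m]_(x in D) (f x)%:E + \int[m]_(x in D) B x)%E.
Proof.
move=> mD A0 B0 mA mB fi AB.
pose g := EFin \o f.
have mf := measurable_int _ fi.
have mp : measurable_fun D (g^\+)%E by exact: measurable_funepos.
have mn : measurable_fun D (g^\-)%E by exact: measurable_funeneg.
have fp := integrable_pos_fin_num mD fi; have fn := integrable_neg_fin_num mD fi.
rewrite [X in (_ <= X + _)%E]integralE -/g.
rewrite addeAC leeBrDr// -!ge0_integralD//.
apply: ae_ge0_le_integral => //.
- by move=> x Dx; rewrite adde_ge0 ?A0 ?funeneg_ge0.
- exact: emeasurable_funD.
- by move=> x Dx; rewrite adde_ge0 ?B0 ?funepos_ge0.
- exact: emeasurable_funD.
apply: filterS AB => x /[apply] ABx.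
rewrite -leeBrDr; last by rewrite funenegE -EFinN -EFin_max.
rewrite addeAC.
by have := congr1 (@^~ x) (funeposneg (fun x => (f x)%:E)) => /= <-.
Qed.

Lemma limn_einf_le (R : realType) (u : nat -> \bar R) (C : \bar R) :
  (forall n, (u n <= C)%E) -> (limn_einf u <= C)%E.
Proof.
move=> uC; rewrite limn_einf_lim; apply: lime_le; first exact: is_cvg_einfs.
apply: nearW => n; apply: le_trans (uC n); apply: ereal_inf_lbound.
by exists n => //=.
Qed.

Lemma fatou_real d (T : measurableType d) (R : realType)
    (m : {measure set T -> \bar R}) (D : set T) (f_ : nat -> T -> R) (f : T -> R) (C : \bar R) :
  measurable D ->
  (forall n, measurable_fun setT (f_ n)) ->
  (forall n x, 0 <= f_ n x) -> (forall x, D x -> f_ n x @[n --> \oo] --> f x) ->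
  (forall n, \int[m]_x (f_ n x)%:E <= C)%E ->
  (\int[m]_(x in D) (f x)%:E <= C)%E.
Proof.
move=> mD mf_ f_0 ff fC.
have mE n : measurable_fun D (EFin \o f_ n) by apply/measurable_EFinP; exact: measurable_funTS.
have := fatou m mD mE (fun n x _ => f_0 n x).
have -> : (\int[m]_(x in D) limn_einf ((fun n => EFin \o f_ n) ^~ x) =
    \int[m]_(x in D) (f x)%:E)%E.
  apply: eq_integral => x; rewrite inE => Dx.
  have fx : (f_ n x)%:E @[n --> \oo] --> (f x)%:E.
    by apply: cvg_EFin; [exact: nearW|exact: ff].
  by have [-> _] := cvg_limn_einf_sup fx.
move=> /le_trans; apply; apply: limn_einf_le => n.
apply: le_trans (fC n).
apply: ge0_subset_integral => //; first exact/measurable_EFinP.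
by move=> x _; rewrite lee_fin.
Qed.

(** Chebyshev's inequality at the atom [x0], where the [f_ n] blow up, shows that
    it is null; Fatou's lemma off [x0] does the rest. *)
Lemma fatou_singular d (T : measurableType d) (R : realType)
    (m : {measure set T -> \bar R}) (x0 : T) (f_ : nat -> T -> R) (f : T -> R) (C : R) :
  measurable [set x0] ->
  (forall n, measurable_fun setT (f_ n)) -> measurable_fun setT f ->
  (forall n x, 0 <= f_ n x) -> (forall x, 0 <= f x) ->
  (forall x, x <> x0 -> f_ n x @[n --> \oo] --> f x) ->
  (forall A : R, \forall n \near \oo, A <= f_ n x0) ->
  (forall n, \int[m]_x (f_ n x)%:E <= C%:E)%E ->
  m [set x0] = 0%E /\ (\int[m]_x (f x)%:E <= C%:E)%E.
Proof.
move=> mx mf_ mf f_0 f0 ff fx fC.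
have mxC : measurable (~` [set x0]) by exact: measurableC.
have C0 : 0 <= C.
  by rewrite -lee_fin (le_trans _ (fC 0%N))// integral_ge0// => x _; rewrite lee_fin.
have m0 : m [set x0] = 0%E.
  apply/eqP; rewrite -measure_le0; apply/lee_addgt0Pr => e e0; rewrite add0e.
  have [n _ /(_ n (leqnn n)) /= An] := fx (C / e + 1).
  have A0 : 0 < C / e + 1 by rewrite ltr_wpDl// divr_ge0// ltW.
  have : ((C / e + 1)%:E * m [set x0] <= C%:E)%E.
    apply: le_trans (fC n).
    apply: (@le_trans _ _ (\int[m]_(x in [set x0]) (f_ n x)%:E)%E); last first.
      apply: ge0_subset_integral => //; first exact/measurable_EFinP.
      by move=> x _; rewrite lee_fin.
    rewrite (eq_integral (cst (f_ n x0)%:E)); last by move=> x; rewrite inE => ->.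
    by rewrite integral_cst// lee_wpmul2r// lee_fin.
  rewrite muleC -lee_pdivlMr// => /le_trans; apply.
  rewrite lee_fin ler_pdivrMr// mulrDr mulrC divfK ?gt_eqF//.
  by rewrite mulr1 lerDl ltW.
split=> //.
rewrite (@ge0_negligible_integral _ _ _ m setT [set x0])// ?setTD.
- by apply: fatou_real => // x /ff; exact.
- exact/measurable_EFinP.
- by move=> x _; rewrite lee_fin.
Qed.

(** * Mixtures of measures *)
Section Mixture.
Context d d' (Z : measurableType d) (Y : measurableType d') (R : realType).
Variables (m : {measure set Z -> \bar R}) (D : set Z).
Variable k : Z -> {measure set Y -> \bar R}.
Hypothesis mD : measurable D.
Hypothesis mk : forall U, measurable U -> measurable_fun [set: Z] (fun z => k z U : \bar R).
Local Open Scope ereal_scope.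

Definition mix (U : set Y) : \bar R := \int[m]_(z in D) k z U.

Let mkD U : measurable U -> measurable_fun D (fun z => k z U : \bar R).
Proof. by move=> mU; exact: measurable_funTS (mk mU). Qed.

Let mix0 : mix set0 = 0.
Proof. by rewrite /mix (eq_integral (cst 0)) ?integral0// => z _; rewrite measure0. Qed.

Let mix_ge0 U : 0 <= mix U. Proof. exact: integral_ge0. Qed.

Let mix_sigma_additive : semi_sigma_additive mix.
Proof.
move=> U mU tU mUU; rewrite [X in _ --> X](_ : _ =
  \int[m]_(z in D) (\sum_(n <oo) k z (U n))); last first.
  apply: eq_integral => z _.
  by apply/esym/cvg_lim => //; exact/measure_semi_sigma_additive.
apply/cvg_closeP; split.
  by apply: is_cvg_nneseries => n _ _; exact: integral_ge0.
by rewrite closeE// integral_nneseries// => n; exact: mkD.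
Qed.

HB.instance Definition _ := isMeasure.Build _ _ R mix mix0 mix_ge0 mix_sigma_additive.

Let mixm : {measure set Y -> \bar R} := mix.

Let mint (f : Y -> \bar R) : (forall y, 0 <= f y) -> measurable_fun setT f ->
  measurable_fun D (fun z => \int[k z]_y f y).
Proof.
by move=> f0 mf; apply: measurable_funTS; exact: measurable_fun_integral_kernel.
Qed.

Import HBNNSimple.

Let ge0_integral_mix_nnsfun (f : {nnsfun Y >-> R}) :
  \int[mixm]_y (f y)%:E = \int[m]_(z in D) \int[k z]_y (f y)%:E.
Proof.
rewrite integralT_nnsfun sintegralE.
under [RHS]eq_integral do rewrite integralT_nnsfun sintegralE.
rewrite ge0_integral_fsum//.
- apply: eq_fsbigr => r _; rewrite [LHS]/=/mix.
  have [r0|r0] := leP 0%R r.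
    by rewrite ge0_integralZl//; apply: mkD; exact: measurable_sfunP.
  rewrite !integral0_eq ?mule0// => z _; first by rewrite preimage_nnfun0// measure0 mule0.
  by rewrite preimage_nnfun0// measure0.
- by move=> r; apply: measurable_funeM; apply: mkD; exact: measurable_sfunP.
- move=> r z _; have := mulemu_ge0 (fun n => f @^-1` [set n]).
  by apply; exact: preimage_nnfun0.
Qed.

Let ge0_integral_mix (f : Y -> \bar R) : (forall y, 0 <= f y) ->
  measurable_fun setT f ->
  \int[mixm]_y f y = \int[m]_(z in D) \int[k z]_y f y.
Proof.
move=> f0 mf; pose f_ := nnsfun_approx measurableT mf.
have mf_ n : measurable_fun setT (EFin \o f_ n) by exact/measurable_EFinP.
have f_0 n y : 0 <= (f_ n y)%:E by rewrite lee_fin.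
have f_nd y : {homo (fun n => (f_ n y)%:E) : a b / (a <= b)%N >-> a <= b}.
  by move=> a b ab; rewrite lee_fin; exact/lefP/nd_nnsfun_approx.
have cvg_f_ (mu : {measure set Y -> \bar R}) :
    \int[mu]_y (f_ n y)%:E @[n --> \oo] --> \int[mu]_y f y.
  rewrite (_ : \int[mu]_y f y = \int[mu]_y (limn (fun n => (f_ n y)%:E))); last first.
    by apply: eq_integral => y _; apply/esym/cvg_lim => //=; exact: cvg_nnsfun_approx.
  exact: cvg_monotone_convergence.
rewrite -(cvg_lim (@ereal_hausdorff R) (cvg_f_ mixm)).
apply/(cvg_lim (@ereal_hausdorff R)).
rewrite (_ : \int[m]_(z in D) _ =
    \int[m]_(z in D) limn (fun n => \int[k z]_y (f_ n y)%:E)); last first.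
  by apply: eq_integral => z _; apply/esym/cvg_lim => //; exact: cvg_f_.
under eq_cvg do rewrite ge0_integral_mix_nnsfun.
apply: cvg_monotone_convergence => //.
- by move=> n; apply: mint; [exact: f_0|exact: mf_].
- by move=> n z _; apply: integral_ge0 => y _; exact: f_0.
- move=> z _ a b ab; apply: ge0_le_integral => //.
  + exact: mf_.
  + exact: mf_.
  + by move=> y _; exact: f_nd.
Qed.

(** The integral formula holds for indicators by construction, then for simple
    functions by linearity and for nonnegative functions by monotone
    convergence. *)
Lemma mixture_exists : exists mu : {measure set Y -> \bar R},
  (forall U, mu U = \int[m]_(z in D) k z U) /\
  forall f : Y -> \bar R, (forall y, 0 <= f y) -> measurable_fun setT f ->
    \int[mu]_y f y = \int[m]_(z in D) \int[k z]_y f y.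
Proof. by exists mixm; split => // f f0 mf; exact: ge0_integral_mix. Qed.

End Mixture.

(** * Kernels on the plane tested on continuous functions *)
Section Caratheodory.
Context d (Z : measurableType d) (R : realType).

Definition grid (n : nat) (s : R) : R := (Num.floor (n.+1%:R * s))%:~R / n.+1%:R.

Lemma grid_cvg (s : R) : grid n s @[n --> \oo] --> s.
Proof.
have ei : (n.+1%:R)^-1 @[n --> \oo] --> (0 : R) by exact: cvg_harmonic.
have cl : s - n.+1%:R^-1 @[n --> \oo] --> s.
  by rewrite -[X in _ --> X]subr0; apply: cvgB => //; exact: cvg_cst.
have cu : (s : R) @[n --> \oo] --> s by exact: cvg_cst.
apply: squeeze_cvgr cl cu; apply: nearW => n; rewrite /grid.
have n0 : 0 < n.+1%:R :> R by [].
have /andP[fl fu] := floor_itv (n.+1%:R * s).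
rewrite ler_pdivrMr// [s * _]mulrC fl andbT ler_pdivlMr// mulrBl mulVf ?gt_eqF//.
by move: fu; rewrite intrD mulrC; lra.
Qed.

(** Freezing the second variable on a grid gives functions with countably many
    measurable pieces, which converge pointwise by continuity. *)
Lemma caratheodory (F : Z -> R -> R) :
  (forall s, measurable_fun setT (F ^~ s)) -> (forall z, continuous (F z)) ->
  measurable_fun setT (fun p : Z * R => F p.1 p.2).
Proof.
move=> mF cF; apply: (@measurable_fun_cvg _ _ _ _ (fun n p => F p.1 (grid n p.2))).
  move=> n _ B mB; rewrite setTI.
  rewrite (_ : _ @^-1` B = \bigcup_(k : int) ((F ^~ (k%:~R / n.+1%:R)) @^-1` B `*`
      [set s | Num.floor (n.+1%:R * s) = k])); last first.
    apply/seteqP; split=> [[z s]/= FB|[z s]/= [k _ [FB fk]]].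
      by exists (Num.floor (n.+1%:R * s)).
    by rewrite /grid fk.
  apply: countable_bigcupT_measurable => // k; apply: measurableX.
    by rewrite -[X in measurable X]setTI; exact: mF.
  have n0 : 0 < n.+1%:R :> R by [].
  rewrite (_ : [set s | _] = `[k%:~R / n.+1%:R, (k + 1)%:~R / n.+1%:R[%classic)//.
  apply/seteqP; split => s /=; rewrite in_itv/= ler_pdivrMr// ltr_pdivlMr// [s * _]mulrC.
    by move/eqP; rewrite floor_eq.
  by rewrite -floor_eq => /eqP.
move=> [z s] _ /=; apply: continuous_cvg; [exact: cF|exact: grid_cvg].
Qed.

End Caratheodory.

Lemma continuous2_measurable (R : realType) (f : R * R -> R) :
  continuous f -> measurable_fun setT f.
Proof.
move=> cf; rewrite (_ : f = fun p => f (p.1, p.2)); last by apply/funext => -[].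
apply: (@caratheodory _ R R (fun a b => f (a, b))).
  move=> s; apply: continuous_measurable_fun => a.
  apply: (@continuous_comp _ _ _ (fun a => (a, s)) f); last exact: cf.
  exact: (cvg_pair cvg_id (cvg_cst s)).
move=> a b; apply: (@continuous_comp _ _ _ (fun b => (a, b)) f); last exact: cf.
exact: (cvg_pair (cvg_cst a) cvg_id).
Qed.

Section ZeroSets.
Context (R : realType).
Implicit Types rho : R * R -> R.

(** Zero sets of nonnegative continuous functions form a pi-system (add the
    functions) generating the Borel sets, and the indicator of one is the limit
    of [expR (- n rho)]: this is what makes continuous test functions
    determine measurability. *)
Definition zero_sets : set (set (R * R)) :=
  [set A | exists rho, [/\ continuous rho, forall y, 0 <= rho y &
                          A = [set y | rho y = 0]]].

Lemma zero_setsI : setI_closed zero_sets.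
Proof.
move=> _ _ [r1 [c1 p1 ->]] [r2 [c2 p2 ->]].
exists (r1 \+ r2); split.
- by move=> y; apply: cvgD; [exact: c1|exact: c2].
- by move=> y; rewrite addr_ge0.
- apply/seteqP; split => y /=; first by move=> [-> ->]; rewrite addr0.
  by move/eqP; rewrite paddr_eq0// => /andP[/eqP -> /eqP ->].
Qed.

Lemma measurable_zero_sets (U : set (R * R)) : measurable U -> <<s zero_sets >> U.
Proof.
pose Y := g_sigma_algebraType zero_sets.
have half (p : R * R -> R) : continuous p -> measurable_fun setT (p : Y -> R).
  move=> cp; apply: (measurability _ (RGenCInfty.measurableE R)).
  move=> _ [_ [a ->] <-]; rewrite setTI; apply: sub_sigma_algebra.
  (* Twice the positive part of [a - p], which vanishes where [a <= p]. *)
  exists (fun y => `|a - p y| + (a - p y)); split.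
  - have c1 : continuous (fun y => a - p y).
      by move=> y; apply: continuousB; [exact: cvg_cst|exact: cp].
    have c2 : continuous (fun y => `|a - p y|).
      by move=> y; apply: (@continuous_comp _ _ _ (fun y => a - p y) (fun z : R => `|z|));
        [exact: c1|exact: norm_continuous].
    by move=> y; exact: (continuousD (c2 y) (c1 y)).
  - by move=> y; have := ler_norm (- (a - p y)); rewrite normrN; lra.
  - apply/seteqP; split => y /=; rewrite in_itv/= andbT.
      by move=> ap; rewrite ler0_norm; lra.
    by have := normr_ge0 (a - p y); lra.
have mid : measurable_fun setT (fun y : Y => (y.1, y.2)).
  by apply: measurable_fun_pair; apply: half; [exact: fst_continuous|exact: snd_continuous].
move=> mU; have := mid measurableT U mU; rewrite setTI.
by rewrite (_ : _ @^-1` U = U)//; apply/seteqP; split => -[].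
Qed.

End ZeroSets.

Section KernelOfCb.
Context d (Z : measurableType d) (R : realType).
Variable k : Z -> {finite_measure set (R * R)%type -> \bar R}.
Hypothesis mk : forall phi, Cb phi ->
  measurable_fun setT (fun z => \int[k z]_y phi y).

Lemma Cb_measurable (phi : R * R -> R) : Cb phi -> measurable_fun setT phi.
Proof. by move=> [c _]; exact: continuous2_measurable. Qed.

Lemma bounded_finite_integrable (mu : {finite_measure set (R * R)%type -> \bar R})
    (f : R * R -> R) (C : R) : measurable_fun setT f -> (forall y, `|f y| <= C) ->
  mu.-integrable setT (EFin \o f).
Proof.
move=> mf fC; apply: measurable_bounded_integrable => //.
  by rewrite ltey_eq fin_num_measure.
by exists C; split; [exact: num_real|move=> M CM y _; exact: le_trans (fC y) (ltW CM)].
Qed.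

Lemma zero_set_kernel (A : set (R * R)) : zero_sets A ->
  measurable_fun setT (fun z => k z A : \bar R).
Proof.
move=> [rho [cr r0 ->]].
pose phi n (y : R * R) := expR (- (n%:R * rho y)).
have cphi n : continuous (phi n).
  move=> y; apply: (@continuous_comp _ _ _ (fun y => - (n%:R * rho y)) expR).
    apply: continuousN; apply: continuousM; [exact: cvg_cst|exact: cr].
  exact: continuous_expR.
have b n y : `|phi n y| <= 1.
  by rewrite ger0_norm ?expR_ge0// expR_le1 oppr_le0 mulr_ge0.
have phiCb n : Cb (phi n) by split; [exact: cphi|exact: bounded_funP (b n)].
have mA : measurable [set y | rho y = 0].
  rewrite -[X in measurable X]setTI.
  exact: (continuous2_measurable cr) measurableT _ (measurable_set1 0).
apply: (emeasurable_fun_cvg (fun n z => \int[k z]_y (phi n y)%:E)%E).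
  move=> n; rewrite (_ : (fun z => _) = (EFin \o fun z => \int[k z]_y phi n y)).
    by apply/measurable_EFinP; exact: mk.
  apply/funext => z /=; rewrite /Rintegral fineK//.
  apply: integrable_fin_num => //.
  exact: (bounded_finite_integrable _ (Cb_measurable (phiCb n)) (b n)).
move=> z _; rewrite -[X in _ --> k z X]setIT -integral_indic//.
apply: (@dominated_cvg _ _ _ _ _ _ (fun n y => (phi n y)%:E) _ (cst 1%E)) => //.
- by move=> n; apply/measurable_EFinP; exact: Cb_measurable.
- move=> y _; rewrite indicE; apply: cvg_EFin; first exact: nearW.
  case: (eqVneq (rho y) 0) => [ry|ry].
    rewrite mem_set//= (_ : fine \o _ = cst 1); first exact: cvg_cst.
    by apply/funext => n; rewrite /= /phi ry mulr0 oppr0 expR0.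
  rewrite memNset/=; last by move=> /=; exact/eqP.
  have rp : 0 < rho y by rewrite lt_def ry r0.
  have -> : fine \o (fun n => (phi n y)%:E) = (fun n => expR (- rho y) ^+ n).
    by apply/funext => n; rewrite /= /phi -expRM_natl mulrN.
  apply: cvg_expr; rewrite ger0_norm ?expR_ge0// expR_lt1; lra.
- have := @bounded_finite_integrable (k z) (cst 1) 1.
  by apply => // y; rewrite normr1.
- by move=> n y _; rewrite lee_fin b.
Qed.

(** By the pi-lambda theorem, from [zero_set_kernel]. *)
Lemma kernel_of_Cb (U : set (R * R)) : measurable U ->
  measurable_fun setT (fun z => k z U : \bar R).
Proof.
pose H := [set U : set (R * R) | measurable U /\ measurable_fun setT (fun z => k z U : \bar R)].
suff : <<s zero_sets (R := R) >> `<=` H by move=> h /measurable_zero_sets /h [].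
apply: lambda_system_subset => //; first exact: zero_setsI.
- split => //.
  + split => //; apply: zero_set_kernel; exists (cst 0); split => //.
      by move=> y; exact: cvg_cst.
    by apply/seteqP; split.
  + move=> A B BA [mA kA] [mB kB]; split; first exact: measurableD.
    rewrite (_ : (fun z => _) = (fun z => k z A - k z B)%E); first exact: emeasurable_funB.
    apply/funext => z; rewrite measureD//; first by rewrite setIidr.
    by rewrite ltey_eq fin_num_measure.
  + move=> F ndF HF; split; first by apply: bigcupT_measurable => i; case: (HF i).
    apply: (emeasurable_fun_cvg (fun i z => k z (F i))).
      by move=> i; case: (HF i).
    move=> z _; apply: nondecreasing_cvg_mu => //.
    - by move=> i; case: (HF i).
    - by apply: bigcupT_measurable => i; case: (HF i).
- move=> A zA; split; last exact: zero_set_kernel.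
  case: zA => rho [cr _ ->]; rewrite -[X in measurable X]setTI.
  exact: (continuous2_measurable cr) measurableT _ (measurable_set1 0).
Qed.

End KernelOfCb.

(** * Mean and occupation measures of a super-Brownian motion *)
Lemma ptws_eval_continuous (I : Type) (V : topologicalType) (i : I) :
  continuous (fun f : {ptws I -> V} => f i).
Proof.
move=> f; have /cvg_sup/(_ i) h : f --> f by apply: cvg_id.
move=> A fA; apply: h.
exact: (@initial_continuous _ _ (fun f : {ptws I -> V} => f i) f A fA).
Qed.

(** Composing with the absolute value extends a path from nonnegative times to
    all real times, so that joint measurability can be stated on [T * R]. *)
Lemma continuous_comp_norm (R : realType) (E : topologicalType) (f : R -> E) :
  {within [set t | 0 <= t], continuous f} -> continuous (fun s : R => f `|s|).
Proof.
move=> /subspace_continuousP cf s.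
have := cf `|s| (normr_ge0 s).
apply: cvg_comp => A /= [e e0 eA].
have := @norm_continuous R R s => /cvgrPdist_lt/(_ e e0).
by apply: filterS => z ze; apply: eA => //=; exact: normr_ge0.
Qed.

Section Process.
Context {R : realType} {d : measure_display} {T : measurableType d}.
Variables (P : probability T R) (F : R -> set (set T)) (X : R -> T -> MF R).
Hypothesis hF : filtration F.
Hypothesis cX : continuous_paths X.
Hypothesis aX : adapted F (X : R -> T -> borelMF R).

Lemma test_continuous (phi : R * R -> R) : Cb phi ->
  continuous (fun mu : MF R => \int[mu]_y phi y).
Proof.
move=> cphi mu.
have c1 := @initial_continuous _ _ (@test_integrals R) mu.
have c2 := @ptws_eval_continuous _ R (exist _ phi cphi : {phi : R * R -> R | Cb phi}).
exact: (continuous_comp c1 (c2 _)).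
Qed.

(** A set [mu phi > a] is weakly open, hence Borel in the space of measures. *)
Lemma test_measurable (phi : R * R -> R) t : Cb phi -> 0 <= t ->
  measurable_fun setT (fun w => \int[X t w]_y phi y).
Proof.
move=> cphi t0; apply: (measurability _ (RGenOInfty.measurableE R)).
move=> _ [_ [a ->] <-]; rewrite setTI.
apply: (filtration_measurable hF t0).
pose O := [set mu : borelMF R | (a < \int[MF_measure mu]_y phi y)].
have mO : measurable O.
  apply: sub_sigma_algebra.
  have := open_comp (fun mu _ => test_continuous cphi (x := mu)) (@open_gt R a).
  by apply.
have := aX t0 mO.
by congr (F t _); apply/seteqP; split => w /=; rewrite in_itv/= andbT.
Qed.

Lemma test_path_continuous (phi : R * R -> R) w : Cb phi ->
  continuous (fun s : R => \int[X `|s| w]_y phi y).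
Proof.
move=> cphi s.
apply: (@continuous_comp _ _ _ (fun s : R => X `|s| w) (fun mu : MF R => \int[mu]_y phi y)).
  exact: (continuous_comp_norm (@cX w)).
exact: test_continuous.
Qed.

Lemma measurable_ker (U : set (R * R)) : measurable U ->
  measurable_fun setT (fun p : T * R => X `|p.2| p.1 U : \bar R).
Proof.
apply: (@kernel_of_Cb _ _ R (fun p : T * R => MF_measure (X `|p.2| p.1))) => phi cphi.
apply: (@caratheodory _ _ _ (fun w (s : R) => \int[X `|s| w]_y phi y)).
  by move=> s; exact: test_measurable.
by move=> w; exact: test_path_continuous.
Qed.

Lemma measurable_kerT t (U : set (R * R)) : 0 <= t -> measurable U ->
  measurable_fun setT (fun w => X t w U : \bar R).
Proof.
move=> t0; apply: (@kernel_of_Cb _ _ R (fun w => MF_measure (X t w))) => phi cphi.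
exact: test_measurable.
Qed.

Local Open Scope ereal_scope.

(** The measure [E X_t]. *)
Lemma mean_measure_exists t : (0 <= t)%R -> exists mu : {measure set (R * R)%type -> \bar R},
  forall f : R * R -> \bar R, (forall y, 0 <= f y) -> measurable_fun setT f ->
    \int[mu]_y f y = \int[P]_w \int[X t w]_y f y.
Proof.
move=> t0.
have [mu [_ muE]] := @mixture_exists _ _ T (R * R)%type R P setT
  (fun w => MF_measure (X t w)) measurableT (fun U mU => measurable_kerT t0 mU).
by exists mu.
Qed.

Lemma tonelli_itv (t : R) (f : T * R -> \bar R) :
  measurable_fun setT f -> (forall p, 0 <= f p) ->
  \int[P \x lebesgue_measure]_(p in setT `*` `[0%R, t]%classic) f p =
    \int[P]_w \int[lebesgue_measure]_(s in `[0%R, t]) f (w, s) /\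
  \int[P \x lebesgue_measure]_(p in setT `*` `[0%R, t]%classic) f p =
    \int[lebesgue_measure]_(s in `[0%R, t]) \int[P]_w f (w, s).
Proof.
move=> mf f0; set D := setT `*` _.
have mD : measurable D by apply: measurableX => //; exact: measurable_itv.
have mr : measurable_fun setT (f \_ D).
  by apply/(measurable_restrictT f mD); exact: measurable_funTS.
have r0 p : 0 <= (f \_ D) p by rewrite patchE; case: ifP.
have rE w s : (f \_ D) (w, s) = ((fun s => f (w, s)) \_ `[0%R, t]%classic) s.
  rewrite !patchE (_ : ((w, s) \in D) = (s \in `[0%R, t]%classic))//.
  by rewrite in_setX in_setT.
split; rewrite [LHS]integral_mkcond.
  rewrite (@fubini_tonelli1 _ _ _ _ _ P (@lebesgue_measure R) (f \_ D) mr r0).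
  apply: eq_integral => w _; rewrite [RHS]integral_mkcond.
  by apply: eq_integral => s _; rewrite rE.
rewrite (@fubini_tonelli2 _ _ _ _ _ P (@lebesgue_measure R) (f \_ D) mr r0).
rewrite [RHS]integral_mkcond; apply: eq_integral => s _; rewrite [RHS]patchE.
case: ifPn => st.
  by apply: eq_integral => w _; rewrite rE patchE st.
by apply: integral0_eq => w _; rewrite rE patchE (negbTE st).
Qed.

Lemma measurable_ker_integral (f : R * R -> \bar R) : (forall y, 0 <= f y) ->
  measurable_fun setT f ->
  measurable_fun setT (fun p : T * R => \int[X `|p.2|%R p.1]_y f y).
Proof.
move=> f0 mf; exact: (@measurable_fun_integral_kernel _ _ (T * R)%type _ R
  (fun p => MF_measure (X `|p.2|%R p.1)) measurable_ker f f0 mf).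
Qed.

Lemma measurable_occ (t : R) w (f : R * R -> \bar R) : (forall y, 0 <= f y) ->
  measurable_fun setT f ->
  measurable_fun `[0%R, t]%classic (fun s => \int[X s w]_y f y).
Proof.
move=> f0 mf.
have mk := measurable_ker_integral f0 mf.
apply: (eq_measurable_fun (fun s : R => \int[X `|s|%R w]_y f y)).
  by move=> s; rewrite inE/= in_itv/= => /andP[s0 _]; rewrite ger0_norm.
apply: measurable_funTS.
exact: (measurableT_comp mk (measurable_pair1 w)).
Qed.

Lemma measurable_mean_occ (t : R) (f : R * R -> \bar R) : (forall y, 0 <= f y) ->
  measurable_fun setT f ->
  measurable_fun setT
    (fun w => \int[lebesgue_measure]_(s in `[0%R, t]) \int[X s w]_y f y).
Proof.
move=> f0 mf.
have mk := measurable_ker_integral f0 mf.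
have mD : measurable (setT `*` `[0%R, t]%classic : set (T * R)).
  by apply: measurableX => //; exact: measurable_itv.
pose g := (fun p : T * R => \int[X `|p.2|%R p.1]_y f y) \_ (setT `*` `[0%R, t]%classic).
have mg : measurable_fun setT g.
  by apply/(measurable_restrictT _ mD); exact: measurable_funTS.
have g0 p : 0 <= g p by rewrite /g patchE; case: ifP => // _; exact: integral_ge0.
have := @measurable_fun_fubini_tonelli_F _ _ _ _ R (@lebesgue_measure R) g mg g0.
congr (measurable_fun _ _); apply/funext => w; rewrite [RHS]integral_mkcond.
apply: eq_integral => s _; rewrite /g !patchE in_setX in_setT/=.
by case: ifP => //; rewrite inE/= in_itv/= => /andP[s0 _]; rewrite ger0_norm.
Qed.

(** The measure [E int_0^t X_s ds]. The two formulas correspond to the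
    definition of the energy and to integration of a bound over time. *)
Lemma occupation_exists (t : R) : (0 <= t)%R -> exists nu : {measure set (R * R)%type -> \bar R},
  forall f : R * R -> \bar R, (forall y, 0 <= f y) -> measurable_fun setT f ->
    \int[nu]_y f y =
      \int[P]_w \int[lebesgue_measure]_(s in `[0%R, t]) \int[X s w]_y f y /\
    \int[nu]_y f y =
      \int[lebesgue_measure]_(s in `[0%R, t]) \int[P]_w \int[X s w]_y f y.
Proof.
move=> t0.
have mD : measurable (setT `*` `[0%R, t]%classic : set (T * R)).
  by apply: measurableX => //; exact: measurable_itv.
have [nu [_ nuE]] := @mixture_exists _ _ _ (R * R)%type R
  (P \x lebesgue_measure) (setT `*` `[0%R, t]%classic)
  (fun p => MF_measure (X `|p.2|%R p.1)) mD measurable_ker.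
have nrm s : s \in `[0%R, t]%classic -> `|s|%R = s.
  by rewrite inE/= in_itv/= => /andP[s0 _]; rewrite ger0_norm.
exists nu => f f0 mf; rewrite nuE//.
have mk := measurable_ker_integral f0 mf.
have k0 (p : T * R) : 0 <= \int[X `|p.2|%R p.1]_y f y by exact: integral_ge0.
have [e1 e2] := tonelli_itv t mk k0.
split; [rewrite e1|rewrite e2].
  by apply: eq_integral => w _; apply: eq_integral => s /nrm /= ->.
by apply: eq_integral => s /nrm /= ->.
Qed.

End Process.

(** * Moment inequalities from the martingale problem *)
Section CbTheory.
Context {R : realType}.
Implicit Types phi psi : R * R -> R.

Lemma Cb_bound phi : Cb phi -> exists C, forall y, `|phi y| <= C.
Proof.
move=> [_ [M [_ hM]]]; exists (M + 1) => y.
by apply: (hM (M + 1)) => //; rewrite ltrDl.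
Qed.

Lemma CbD phi psi : Cb phi -> Cb psi -> Cb (fun y => phi y + psi y).
Proof.
move=> h1 h2; have [C1 b1] := Cb_bound h1; have [C2 b2] := Cb_bound h2.
split; first by move=> y; exact: (continuousD (h1.1 y) (h2.1 y)).
apply: (@bounded_funP _ _ (C1 + C2)) => y.
by rewrite (le_trans (ler_normD _ _))// lerD.
Qed.

Lemma CbZ (a : R) phi : Cb phi -> Cb (fun y => a * phi y).
Proof.
move=> h; have [C b] := Cb_bound h.
split; first by move=> y; apply: continuousM; [exact: cvg_cst|exact: h.1].
by apply: (@bounded_funP _ _ (`|a| * C)) => y; rewrite normrM ler_wpM2l.
Qed.

Lemma Cb_cst (a : R) : Cb (fun _ => a).
Proof.
split; first by move=> y; exact: cvg_cst.
by apply: (@bounded_funP _ _ `|a|) => y.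
Qed.

Lemma Cb_half_laplacian phi : Cb2 phi -> Cb (fun y => 2^-1 * laplacian phi y).
Proof.
move=> [_ _ h]; apply: CbZ.
rewrite (_ : laplacian phi = fun y => partial 0 (partial 0 phi) y + partial 1 (partial 1 phi) y).
  by apply: CbD; [exact: (h 0 0).2|exact: (h 1 1).2].
apply/funext => y; rewrite /laplacian big_ord_recr big_ord1.
by congr (partial _ (partial _ _) _ + partial _ (partial _ _) _); apply/val_inj.
Qed.

Lemma Cb_integrable (mu : {finite_measure set (R * R)%type -> \bar R}) phi :
  Cb phi -> mu.-integrable setT (EFin \o phi).
Proof.
move=> h; have [C b] := Cb_bound h.
exact: (bounded_finite_integrable _ (Cb_measurable h) b).
Qed.

End CbTheory.

Section Moments.
Context {R : realType} {d : measure_display} {T : measurableType d}.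
Variables (P : probability T R) (F : R -> set (set T)) (X : R -> T -> MF R).
Hypothesis hF : filtration F.
Hypothesis hX : super_brownian_motion P F X (\d_(0 : R * R)).
Implicit Types phi : R * R -> R.

Let cX := sbm_continuous hX.
Let aX := sbm_adapted hX.

(** A martingale starting at zero has mean zero: take the whole space as event
    at time zero. *)
Lemma mp_mean0 phi t : Cb2 phi -> 0 <= t ->
  P.-integrable setT (EFin \o mp_martingale X phi t) /\
  (\int[P]_w (mp_martingale X phi t w)%:E = 0)%E.
Proof.
move=> h t0; have [[_ ih mh] _ z _] := sbm_mp hX h.
split; first exact: ih.
have sF := filtration_sigma hF (lexx (0 : R)).
have FT : F 0 setT by have [h0 hC _] := sF; rewrite -(setD0 setT); exact: hC.
rewrite (mh 0 t (lexx 0) t0 setT FT).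
by apply: integral0_eq => w _; rewrite z.
Qed.

Lemma init_test : {ae P, forall w, forall phi, measurable_fun setT phi ->
  \int[X 0 w]_y phi y = phi 0}.
Proof.
apply: filterS (sbm_init hX) => w Xw phi mphi.
rewrite /Rintegral (@eq_measure_integral _ _ _ _ (\d_(0 : R * R))); last first.
  by move=> A mA _; exact: Xw.
by rewrite integral_dirac// ?diracT ?mul1e//; exact/measurable_EFinP.
Qed.

Lemma path_integrable phi t w : Cb phi ->
  lebesgue_measure.-integrable `[0, t] (EFin \o (fun s => \int[X s w]_y phi y)).
Proof.
move=> h.
have : lebesgue_measure.-integrable `[0, t] (EFin \o (fun s : R => \int[X `|s| w]_y phi y)).
  apply: continuous_compact_integrable; first exact: segment_compact.
  exact/continuous_subspaceT/test_path_continuous.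
apply: eq_integrable => // s; rewrite inE/= in_itv/= => /andP[s0 _].
by rewrite ger0_norm.
Qed.

Definition occ phi t w : R := \int[lebesgue_measure]_(s in `[0, t]) \int[X s w]_y phi y.

(** Integrating the two pointwise inequalities against [X_t] and [X_s] bounds
    the left-hand side by [sg * (X_t(phi) - int_0^t X_s(half Laplacian) ds)] plus
    the terms in [b1] and [b2]; by definition of the martingale, that bracket is
    [phi 0] plus the martingale. *)
Lemma mp_le phi (sg c t : R) (a1 b1 a2 b2 : R * R -> R) : Cb2 phi -> 0 <= t ->
  measurable_fun setT a1 -> measurable_fun setT b1 ->
  measurable_fun setT a2 -> measurable_fun setT b2 ->
  (forall y, 0 <= a1 y) -> (forall y, 0 <= b1 y) ->
  (forall y, 0 <= a2 y) -> (forall y, 0 <= b2 y) ->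
  (forall y, a1 y <= sg * phi y + b1 y) ->
  (forall y, a2 y + sg * (2^-1 * laplacian phi y) <= b2 y) ->
  sg * phi 0 <= c ->
  {ae P, forall w,
    (\int[X t w]_y (a1 y)%:E +
      \int[lebesgue_measure]_(s in `[0%R, t]) \int[X s w]_y (a2 y)%:E <=
     (c + sg * mp_martingale X phi t w)%:E + (\int[X t w]_y (b1 y)%:E +
      \int[lebesgue_measure]_(s in `[0%R, t]) \int[X s w]_y (b2 y)%:E))%E}.
Proof.
move=> h t0 ma1 mb1 ma2 mb2 a10 b10 a20 b20 ab1 ab2 hc.
have hL := Cb_half_laplacian h.
have hphi : Cb phi by case: h.
apply: filterS init_test => w X0.
have iZ (mu : {finite_measure set (R * R)%type -> \bar R}) (a : R) psi : Cb psi ->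
    (\int[mu]_y (a * psi y)%:E = (a * \int[mu]_y psi y)%:E)%E.
  move=> hpsi; rewrite EFinM /Rintegral fineK; last first.
    by apply: integrable_fin_num => //; exact: Cb_integrable.
  by rewrite -integralZl//; exact: Cb_integrable.
have h1 : (\int[X t w]_y (a1 y)%:E <=
    (sg * \int[X t w]_y phi y)%:E + \int[X t w]_y (b1 y)%:E)%E.
  rewrite -iZ//; apply: le_integral_shift => //.
  - by move=> y _; rewrite lee_fin.
  - by move=> y _; rewrite lee_fin.
  - exact/measurable_EFinP.
  - exact/measurable_EFinP.
  - exact: Cb_integrable (CbZ sg hphi).
  - by apply: aeW => y _; rewrite -EFinD lee_fin.
have h2 s : (\int[X s w]_y (a2 y)%:E <=
    (- sg * \int[X s w]_y (2^-1 * laplacian phi y))%:E + \int[X s w]_y (b2 y)%:E)%E.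
  rewrite -iZ//; apply: le_integral_shift => //.
  - by move=> y _; rewrite lee_fin.
  - by move=> y _; rewrite lee_fin.
  - exact/measurable_EFinP.
  - exact/measurable_EFinP.
  - exact: Cb_integrable (CbZ (- sg) hL).
  - by apply: aeW => y _; rewrite -EFinD lee_fin mulNr; have := ab2 y; lra.
have io := path_integrable t w hL.
have h3 : (\int[lebesgue_measure]_(s in `[0%R, t]) \int[X s w]_y (a2 y)%:E <=
   (- sg * occ (fun y => 2^-1 * laplacian phi y) t w)%:E +
   \int[lebesgue_measure]_(s in `[0%R, t]) \int[X s w]_y (b2 y)%:E)%E.
  have -> : (- sg * occ (fun y => 2^-1 * laplacian phi y) t w)%:E =
      (\int[lebesgue_measure]_(s in `[0%R, t])
        (- sg * \int[X s w]_y (2^-1 * laplacian phi y))%:E)%E.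
    rewrite EFinM /occ /Rintegral fineK; last exact: integrable_fin_num.
    by rewrite -integralZl.
  apply: le_integral_shift => //.
  - by move=> s _; apply: integral_ge0 => y _; rewrite lee_fin.
  - by move=> s _; apply: integral_ge0 => y _; rewrite lee_fin.
  - by apply: (measurable_occ hF cX aX) => [y|]; [rewrite lee_fin|exact/measurable_EFinP].
  - by apply: (measurable_occ hF cX aX) => [y|]; [rewrite lee_fin|exact/measurable_EFinP].
  - have mI : measurable (`[0, t]%classic : set (measurableTypeR R)).
      exact: measurable_itv.
    by have := integrableZl mI (- sg) io.
  - by apply: aeW => s _; exact: h2.
apply: (le_trans (leeD h1 h3)).
rewrite addeACA -EFinD leeD2r// lee_fin /mp_martingale -/(occ _ t w).
by rewrite X0; [lra|exact: Cb_measurable].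
Qed.

(** The martingale disappears in expectation. The a priori bounds below rest on
    instances of this inequality: [a1] and [a2] are the functions to be
    integrated against the mean and the occupation measure, and [sg] is [1] or
    [-1]. *)
Lemma moment_le phi (sg c t : R) (a1 b1 a2 b2 : R * R -> R)
    (mu nu : {measure set (R * R)%type -> \bar R}) : Cb2 phi -> 0 <= t ->
  (forall f : R * R -> \bar R, (forall y, 0 <= f y)%E -> measurable_fun setT f ->
    \int[mu]_y f y = \int[P]_w \int[X t w]_y f y)%E ->
  (forall f : R * R -> \bar R, (forall y, 0 <= f y)%E -> measurable_fun setT f ->
    \int[nu]_y f y =
      \int[P]_w \int[lebesgue_measure]_(s in `[0%R, t]) \int[X s w]_y f y)%E ->
  measurable_fun setT a1 -> measurable_fun setT b1 ->
  measurable_fun setT a2 -> measurable_fun setT b2 ->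
  (forall y, 0 <= a1 y) -> (forall y, 0 <= b1 y) ->
  (forall y, 0 <= a2 y) -> (forall y, 0 <= b2 y) ->
  (forall y, a1 y <= sg * phi y + b1 y) ->
  (forall y, a2 y + sg * (2^-1 * laplacian phi y) <= b2 y) ->
  sg * phi 0 <= c ->
  (\int[mu]_y (a1 y)%:E + \int[nu]_y (a2 y)%:E <=
   c%:E + (\int[mu]_y (b1 y)%:E + \int[nu]_y (b2 y)%:E))%E.
Proof.
move=> h t0 muE nuE ma1 mb1 ma2 mb2 a10 b10 a20 b20 ab1 ab2 hc.
have path := mp_le h t0 ma1 mb1 ma2 mb2 a10 b10 a20 b20 ab1 ab2 hc.
have m_ (f : R * R -> R) : measurable_fun setT f ->
    measurable_fun setT (EFin \o f : R * R -> \bar R).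
  by move=> ?; exact/measurable_EFinP.
have n_ (f : R * R -> R) : (forall y, 0 <= f y) -> forall y, (0 <= (f y)%:E)%E.
  by move=> f0 y; rewrite lee_fin.
have mX (f : R * R -> R) : (forall y, 0 <= f y) -> measurable_fun setT f ->
    measurable_fun setT (fun w => \int[X t w]_y (f y)%:E)%E.
  move=> f0 mf; apply: (@measurable_fun_integral_kernel _ _ T _ R (fun w => MF_measure (X t w))).
  - by move=> U mU; exact: (measurable_kerT hF aX).
  - exact: n_.
  - exact: m_.
have mO (f : R * R -> R) : (forall y, 0 <= f y) -> measurable_fun setT f ->
    measurable_fun setT (fun w =>
      \int[lebesgue_measure]_(s in `[0%R, t]) \int[X s w]_y (f y)%:E)%E.
  by move=> f0 mf; apply: (measurable_mean_occ hF cX aX); [exact: n_|exact: m_].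
rewrite !muE; [|exact: n_|exact: m_|exact: n_|exact: m_].
rewrite !nuE; [|exact: n_|exact: m_|exact: n_|exact: m_].
have nX (f : R * R -> R) w : (forall y, 0 <= f y) -> (0 <= \int[X t w]_y (f y)%:E)%E.
  by move=> f0; apply: integral_ge0 => y _; rewrite lee_fin.
have nO (f : R * R -> R) w : (forall y, 0 <= f y) ->
    (0 <= \int[lebesgue_measure]_(s in `[0%R, t]) \int[X s w]_y (f y)%:E)%E.
  by move=> f0; apply: integral_ge0 => s _; apply: integral_ge0 => y _; rewrite lee_fin.
have eD (f g : R * R -> R) : measurable_fun setT f -> measurable_fun setT g ->
    (forall y, 0 <= f y) -> (forall y, 0 <= g y) ->
    (\int[P]_w \int[X t w]_y (f y)%:E + \int[P]_w
      \int[lebesgue_measure]_(s in `[0%R, t]) \int[X s w]_y (g y)%:E =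
     \int[P]_w (\int[X t w]_y (f y)%:E +
      \int[lebesgue_measure]_(s in `[0%R, t]) \int[X s w]_y (g y)%:E))%E.
  move=> mf mg f0 g0; rewrite [RHS]ge0_integralD//.
  - by move=> w _; exact: nX.
  - exact: mX.
  - by move=> w _; exact: nO.
  - exact: mO.
rewrite (eD a1 a2)// (eD b1 b2)//.
have [imp mp0] := mp_mean0 h t0.
have icst : P.-integrable setT (cst c%:E).
  exact: finite_measure_integrable_cst.
have isg : P.-integrable setT (fun w => (sg * mp_martingale X phi t w)%:E).
  by have := integrableZl measurableT sg imp.
have ic : P.-integrable setT (EFin \o (fun w => c + sg * mp_martingale X phi t w)).
  by have := integrableD measurableT icst isg.
have -> : c%:E = (\int[P]_w (c + sg * mp_martingale X phi t w)%:E)%E.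
  have e0 : (\int[P]_w (sg * mp_martingale X phi t w)%:E = 0)%E.
    by have := integralZl measurableT imp sg; rewrite mp0 mule0.
  have e1 : (\int[P]_w (cst c%:E) w = c%:E)%E.
    rewrite integral_cst//; have := @probability_setT _ _ _ P.
    by move=> e; rewrite -[RHS]mule1 -[in RHS]e.
  by have := integralD measurableT icst isg; rewrite e0 e1 adde0.
apply: le_integral_shift => //.
- by move=> w _; rewrite adde_ge0 ?nX ?nO.
- by move=> w _; rewrite adde_ge0 ?nX ?nO.
- by apply: emeasurable_funD; [exact: mX|exact: mO].
- by apply: emeasurable_funD; [exact: mX|exact: mO].
- by apply: filterS path => w pw _.
Qed.

End Moments.

(** * Mass and second moments *)
Section Instances.
Context {R : realType} {d : measure_display} {T : measurableType d}.
Variables (P : probability T R) (F : R -> set (set T)) (X : R -> T -> MF R).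
Hypothesis hF : filtration F.
Hypothesis hX : super_brownian_motion P F X (\d_(0 : R * R)).
Variable x : R * R.

Let cX := sbm_continuous hX.
Let aX := sbm_adapted hX.

Definition is_mean_measure t (mu : {measure set (R * R)%type -> \bar R}) :=
  forall f : R * R -> \bar R, (forall y, 0 <= f y)%E -> measurable_fun setT f ->
    (\int[mu]_y f y = \int[P]_w \int[X t w]_y f y)%E.

Definition is_occupation_measure (t : R) (nu : {measure set (R * R)%type -> \bar R}) :=
  forall f : R * R -> \bar R, (forall y, 0 <= f y)%E -> measurable_fun setT f ->
    (\int[nu]_y f y =
      \int[P]_w \int[lebesgue_measure]_(s in `[0%R, t]) \int[X s w]_y f y)%E /\
    (\int[nu]_y f y =
      \int[lebesgue_measure]_(s in `[0%R, t]) \int[P]_w \int[X s w]_y f y)%E.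

Lemma measurable_mean_flow (t : R) (f : R * R -> \bar R) : (forall y, 0 <= f y)%E ->
  measurable_fun setT f ->
  measurable_fun `[0, t]%classic (fun s => \int[P]_w \int[X s w]_y f y)%E.
Proof.
move=> f0 mf.
have mk := measurable_ker_integral hF cX aX f0 mf.
have k0 (p : T * R) : (0 <= \int[X `|p.2|%R p.1]_y f y)%E by exact: integral_ge0.
apply: (eq_measurable_fun (fun s : R => \int[P]_w \int[X `|s|%R w]_y f y)%E).
  by move=> s; rewrite inE/= in_itv/= => /andP[s0 _]; rewrite ger0_norm.
apply: measurable_funTS.
exact: (@measurable_fun_fubini_tonelli_G _ _ T R R P _ mk k0).
Qed.

(** Tonelli: the occupation measure averages the mean measures over time. *)
Lemma occupation_le (t : R) nu (f : R * R -> R) (C : R) : 0 <= t ->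
  is_occupation_measure t nu -> (forall y, 0 <= f y) -> measurable_fun setT f ->
  (forall s mu, 0 <= s <= t -> is_mean_measure s mu ->
    (\int[mu]_y (f y)%:E <= C%:E)%E) ->
  (\int[nu]_y (f y)%:E <= (t * C)%:E)%E.
Proof.
move=> t0 nuE f0 mf hC.
have f0' y : (0 <= (f y)%:E)%E by rewrite lee_fin.
have mf' : measurable_fun setT (EFin \o f) by exact/measurable_EFinP.
have [_ ->] := nuE _ f0' mf'.
have -> : (t * C)%:E = (\int[lebesgue_measure]_(s in `[0%R, t]) (cst C%:E) s)%E.
  rewrite integral_cst//.
  have e : lebesgue_measure (`[0, t]%classic : set R) = t%:E.
    rewrite lebesgue_measure_itv/= lte_fin; case: ltP => t1.
      by rewrite -EFinD subr0.
    by congr (_%:E); lra.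
  rewrite EFinM muleC; congr (_ * _)%E; exact: esym e.
apply: ge0_le_integral => //.
- by move=> s _; apply: integral_ge0 => w _; exact: integral_ge0.
- exact: measurable_mean_flow.
- move=> s; rewrite /= in_itv/= => /[dup] st /andP[s0 _].
  have [mu muE] := mean_measure_exists P hF aX s0.
  by have := hC s mu st muE; rewrite muE.
Qed.

Lemma cst_Cb2 (a : R) : Cb2 (fun _ : R * R => a) /\
  forall y, 2^-1 * laplacian (fun _ : R * R => a) y = 0.
Proof.
have [||||cb2 lap] := @radial_Cb2 _ (0 : R * R) (cst a) (cst 0) (cst 0) `|a|.
- by move=> q _; exact: cvg_cst.
- by [].
- by move=> q q0; rewrite normr0 mulr0.
- by move=> q q0; rewrite normr0 mulr0.
by split => // y; rewrite lap !mulr0 addr0 mulr0.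
Qed.

Lemma integral_cst0 (m : {measure set (R * R)%type -> \bar R}) :
  (\int[m]_y (cst (0 : R) y)%:E = 0)%E.
Proof. exact: integral0_eq. Qed.

(** The constant function has zero Laplacian: apply [moment_le] to it. *)
Lemma mean_mass t mu : 0 <= t -> is_mean_measure t mu ->
  (\int[mu]_y (cst (1 : R) y)%:E <= 1%:E)%E.
Proof.
move=> t0 muE; have [nu nuE] := occupation_exists P hF cX aX t0.
have [c1 l1] := cst_Cb2 1.
have H : (\int[mu]_y (cst (1 : R) y)%:E + \int[nu]_y (cst (0 : R) y)%:E <=
    1%:E + (\int[mu]_y (cst (0 : R) y)%:E + \int[nu]_y (cst (0 : R) y)%:E))%E.
  apply: (moment_le hF hX (sg := 1) c1 t0 muE (fun f f0 mf => (nuE f f0 mf).1)) => //.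
  all: try by move=> y; rewrite /= ?l1; lra.
by move: H; rewrite !integral_cst0 !adde0.
Qed.

Lemma occupation_mass t nu : 0 <= t -> is_occupation_measure t nu ->
  (\int[nu]_y (cst (1 : R) y)%:E <= t%:E)%E.
Proof.
move=> t0 nuE; have := @occupation_le t nu (cst 1) 1 t0 nuE.
rewrite mulr1; apply => // s mu /andP[s0 _] muE.
exact: mean_mass s0 muE.
Qed.

Lemma occupation_cst_le t nu (a : R) : 0 <= t -> 0 <= a ->
  is_occupation_measure t nu -> (\int[nu]_y (cst a y)%:E <= (a * t)%:E)%E.
Proof.
move=> t0 a0 nuE.
have -> : (\int[nu]_y (cst a y)%:E = a%:E * \int[nu]_y (cst (1 : R) y)%:E)%E.
  rewrite -ge0_integralZl//; last exact/measurable_EFinP/measurable_cst.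
  by apply: eq_integral => y _; rewrite /= mule1.
rewrite EFinM; apply: lee_wpmul2l; first by rewrite lee_fin.
exact: (occupation_mass t0 nuE).
Qed.

Lemma measurable_sqdist : measurable_fun setT (sqdist x).
Proof. by apply: continuous2_measurable; exact: continuous_sqdist. Qed.

Lemma Cb2_measurable (phi : R * R -> R) : Cb2 phi -> measurable_fun setT phi.
Proof. by move=> [h _ _]; exact: Cb_measurable. Qed.

(** [momprof N] has half Laplacian at most [2], so that the second moment grows at
    most like that of a planar Brownian motion; Fatou lets [N] tend to
    infinity. *)
Lemma mean_sqdist t mu : 0 <= t -> is_mean_measure t mu ->
  (\int[mu]_y (sqdist x y)%:E <= (sqdist x 0%R + 2 * t)%:E)%E.
Proof.
move=> t0 muE; have [nu nuE] := occupation_exists P hF cX aX t0.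
have N1 n : 1 <= n.+1%:R :> R by rewrite ler1n.
have N0 n : 0 < n.+1%:R :> R by [].
apply: (@fatou_real _ _ _ mu setT (fun n y => momprof n.+1%:R (sqdist x y))) => //.
- by move=> n; have [h _] := momprof_Cb2 x (N1 n); exact: Cb2_measurable h.
- by move=> n y; rewrite momprof_ge0// sqdist_ge0.
- by move=> y _; apply: momprof_cvg; exact: sqdist_ge0.
move=> n; have [h l] := momprof_Cb2 x (N1 n).
have H : (\int[mu]_y (momprof n.+1%:R (sqdist x y))%:E + \int[nu]_y (cst (0 : R) y)%:E <=
    (sqdist x 0)%:E + (\int[mu]_y (cst (0 : R) y)%:E + \int[nu]_y (cst (2 : R) y)%:E))%E.
  apply: (moment_le hF hX (sg := 1) h t0 muE (fun f f0 mf => (nuE f f0 mf).1)) => //.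
  - exact: Cb2_measurable h.
  - by move=> y; rewrite momprof_ge0// sqdist_ge0.
  - by move=> y; rewrite mul1r addr0.
  - by move=> y; rewrite add0r mul1r.
  - by rewrite mul1r momprof_le// sqdist_ge0.
move: H; rewrite !integral_cst0 adde0 add0e => /le_trans; apply.
rewrite (EFinD (sqdist x 0)); apply: leeD2l.
exact: occupation_cst_le.
Qed.

Lemma occupation_sqdist t nu : 0 <= t -> is_occupation_measure t nu ->
  (\int[nu]_y (sqdist x y)%:E <= (t * (sqdist x 0%R + 2 * t))%:E)%E.
Proof.
move=> t0 nuE; apply: (@occupation_le t nu (sqdist x)) => //.
- exact: sqdist_ge0.
- exact: measurable_sqdist.
move=> s mu /andP[s0 st] muE; apply: le_trans (mean_sqdist s0 muE) _.
by rewrite lee_fin lerD2l ler_wpM2l.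
Qed.

End Instances.

(** * Logarithmic moments *)
(** The regularization [s / (s^2 + 1 / (n + 1))] is continuous and converges to
    [s^-1] everywhere, including at [0] where [0^-1 = 0]. *)
Lemma measurable_invr (R : realType) : measurable_fun setT (fun s : R => s^-1).
Proof.
apply: (@measurable_fun_cvg _ _ _ _ (fun n (s : R) => s * (s ^+ 2 + n.+1%:R^-1)^-1)).
  move=> n; apply: continuous_measurable_fun.
  have c0 : continuous (fun s : R => s) by move=> s; exact: cvg_id.
  have c1 : continuous (fun s : R => s ^+ 2 + n.+1%:R^-1).
    move=> s; apply: (@continuousD _ _ _ (fun s : R => s ^+ 2) (cst (n.+1%:R^-1))).
      exact: exprn_continuous.
    exact: cvg_cst.
  have p0 s : s ^+ 2 + n.+1%:R^-1 != 0 :> R.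
    by rewrite gt_eqF// ltr_wpDl ?sqr_ge0// invr_gt0.
  have c2 : continuous (fun s : R => (s ^+ 2 + n.+1%:R^-1)^-1).
    by move=> s; apply: cvgV; [exact: p0|exact: c1].
  by move=> s; apply: cvgM; [exact: c0|exact: c2].
move=> s _; have [->|s0] := eqVneq s 0.
  by rewrite invr0; under eq_cvg do rewrite mul0r; exact: cvg_cst.
have -> : s^-1 = s * (s ^+ 2 + 0)^-1 by rewrite addr0 expr2 invfM mulrA mulfV// mul1r.
apply: cvgM; first exact: cvg_cst.
apply: cvgV; first by rewrite addr0 sqrf_eq0.
by apply: cvgD; [exact: cvg_cst|exact: cvg_harmonic].
Qed.

Section LogMoments.
Context {R : realType} {d : measure_display} {T : measurableType d}.
Variables (P : probability T R) (F : R -> set (set T)) (X : R -> T -> MF R).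
Hypothesis hF : filtration F.
Hypothesis hX : super_brownian_motion P F X (\d_(0 : R * R)).
Variable x : R * R.

Let cX := sbm_continuous hX.
Let aX := sbm_adapted hX.

Lemma log_distE y : log_dist x y = 2^-1 * ln (sqdist x y).
Proof.
have [->|yx] := eqVneq y x.
  rewrite /log_dist /sqdist subrr /enorm /= expr0n /= addr0 sqrtr0.
  by rewrite !subrr expr0n addr0 ln0// mulr0.
have q0 : 0 < sqdist x y by rewrite sqdist_gt0.
have e0 : 0 < enorm (y - x) by rewrite sqrtr_gt0.
by rewrite /log_dist -enormB_sqr lnXn// mulr2n; field.
Qed.

Lemma measurable_log_dist : measurable_fun setT (log_dist x).
Proof.
rewrite (_ : log_dist x = (fun y => 2^-1 * ln (sqdist x y))); last first.
  by apply/funext => y; rewrite log_distE.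
apply: measurable_funM; first exact: measurable_cst.
exact: (measurableT_comp (@measurable_ln R) (measurable_sqdist x)).
Qed.

Lemma measurable_sing_dist (dlt : R) :
  measurable_fun setT (fun y => sing (Num.sqrt (sqdist x y + dlt))).
Proof.
have ms : measurable_fun setT (fun y => Num.sqrt (sqdist x y + dlt)).
  apply: (measurableT_comp (f := @Num.sqrt R)).
    by apply: continuous_measurable_fun; exact: sqrt_continuous.
  by apply: measurable_funD; [exact: measurable_sqdist|exact: measurable_cst].
apply: (measurableT_comp (@measurable_invr R)).
apply: measurable_funM => //; apply: measurable_funX.
by apply: measurable_funD => //; exact: measurable_cst.
Qed.

Lemma measurable_set_pt : measurable [set x].
Proof.
rewrite (_ : [set x] = [set x.1] `*` [set x.2]); first exact: measurableX.
by apply/seteqP; split => [y -> //|[a b] /= [-> ->]]; case: x.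
Qed.

(** Apply [moment_le] to the bounded function [1 / (1 + sqrt (q + dlt))]: half
    its Laplacian is at most [1 / 2] minus half the singular density. *)
Lemma occupation_sing t nu n : 0 <= t -> is_occupation_measure P X t nu ->
  (\int[nu]_y (2^-1 * sing (Num.sqrt (sqdist x y + smallsq n)))%:E
    <= (1 + 2^-1 * t)%:E)%E.
Proof.
move=> t0 nuE; have [mu muE] := mean_measure_exists P hF aX t0.
have dl : 0 < smallsq n :> R := smallsq_gt0 n.
have [h l] := sqprof_Cb2 x dl.
have rg y := sqprof_range (sqdist_ge0 x y) dl.
have H : (\int[mu]_y (cst (0 : R) y)%:E +
     \int[nu]_y (2^-1 * sing (Num.sqrt (sqdist x y + smallsq n)))%:E <=
    1%:E + (\int[mu]_y (cst (0 : R) y)%:E + \int[nu]_y (cst (2^-1 : R) y)%:E))%E.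
  apply: (moment_le hF hX (sg := -1) h t0 muE (fun f f0 mf => (nuE f f0 mf).1)) => //.
  - apply: measurable_funM; [exact: measurable_cst|exact: measurable_sing_dist].
  - move=> y; rewrite mulr_ge0// ltW// sing_gt0// sqrtr_gt0.
    by have := sqdist_ge0 x y; lra.
  - by move=> y; rewrite /cst invr_ge0.
  - by move=> y; have /andP[_ ?] := rg y; rewrite addr0 mulN1r oppr_ge0.
  - by move=> y; have := l y; rewrite mulN1r /cst; lra.
  - by have /andP[? _] := rg 0; rewrite mulN1r lerNl.
move: H; rewrite !integral_cst0 !add0e => /le_trans; apply.
rewrite (EFinD 1); apply: leeD2l.
apply: (occupation_cst_le hF hX t0 _ nuE).
by rewrite invr_ge0.
Qed.

(** The squared logarithm is dominated by [1 / r] near [x] and by [q] far away;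
    since the approximations of [1 / r] blow up at [x], that point is null. *)
Lemma occupation_log t nu : 0 <= t -> is_occupation_measure P X t nu ->
  nu [set x] = 0%E /\ (\int[nu]_y ((log_dist x y) ^+ 2)%:E < +oo)%E.
Proof.
move=> t0 nuE.
have [||||||||nx hs] := @fatou_singular _ _ R nu x
  (fun n y => 2^-1 * sing (Num.sqrt (sqdist x y + smallsq n)))
  (fun y => 2^-1 * sing (Num.sqrt (sqdist x y))) (1 + 2^-1 * t).
- exact: measurable_set_pt.
- by move=> n; apply: measurable_funM; [exact: measurable_cst|exact: measurable_sing_dist].
- have := measurable_sing_dist 0; under eq_fun do rewrite addr0.
  by move=> ms; apply: measurable_funM => //; exact: measurable_cst.
- move=> n y; rewrite mulr_ge0// ltW// sing_gt0// sqrtr_gt0.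
  by have := sqdist_ge0 x y; have : 0 < smallsq n :> R := smallsq_gt0 n; lra.
- move=> y; rewrite mulr_ge0// invr_ge0 mulr_ge0 ?sqrtr_ge0// exprn_ge0// addr_ge0// sqrtr_ge0.
- move=> y yx; apply: cvgM; first exact: cvg_cst.
  by apply: sing_cvg; rewrite sqdist_gt0; exact/eqP.
- move=> A; have := sing0_cvg (2 * A); apply: filterS => n.
  by rewrite (_ : sqdist x x = 0); [lra|apply/eqP; rewrite sqdist_eq0].
- by move=> n; exact: occupation_sing.
split=> //.
have hq := occupation_sqdist hF hX x t0 nuE.
have s0 y : 0 <= 2^-1 * sing (Num.sqrt (sqdist x y)).
  by rewrite mulr_ge0// invr_ge0 mulr_ge0 ?sqrtr_ge0// exprn_ge0// addr_ge0// sqrtr_ge0.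
have ms : measurable_fun setT (fun y => 2^-1 * sing (Num.sqrt (sqdist x y))).
  have := measurable_sing_dist 0; under eq_fun do rewrite addr0.
  by move=> ms; apply: measurable_funM => //; exact: measurable_cst.
have mq := measurable_sqdist x.
have m64 : measurable_fun setT
    (fun y => 64%:E * (2^-1 * sing (Num.sqrt (sqdist x y)))%:E : \bar R)%E.
  by apply: measurable_funeM; exact/measurable_EFinP.
apply: (@le_lt_trans _ _ (\int[nu]_y (64%:E * (2^-1 * sing (Num.sqrt (sqdist x y)))%:E
   + (sqdist x y)%:E))%E).
  apply: ge0_le_integral => //.
  - by move=> y _; rewrite lee_fin sqr_ge0.
  - by apply/measurable_EFinP; apply: measurable_funX; exact: measurable_log_dist.
  - by apply: emeasurable_funD => //; exact/measurable_EFinP.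
  - move=> y _; rewrite -EFinM -EFinD lee_fin log_distE.
    have [q0|q0] := ltP 0 (sqdist x y).
      by have := ln_sqr_le_sing q0; lra.
    rewrite ln0// mulr0 expr0n /= addr_ge0 ?sqdist_ge0// mulr_ge0//.
rewrite ge0_integralD//.
- rewrite ge0_integralZl//; last 2 first.
  + exact/measurable_EFinP.
  + by move=> y _; rewrite lee_fin.
  apply: (@le_lt_trans _ _ (64%:E * (1 + 2^-1 * t)%:E +
    (t * (sqdist x 0%R + 2 * t))%:E)%E); last by rewrite -EFinM -EFinD ltry.
  by apply: leeD => //; apply: lee_wpmul2l.
- by move=> y _; rewrite mule_ge0// lee_fin.
- by move=> y _; rewrite lee_fin sqdist_ge0.
- exact/measurable_EFinP.
Qed.

(** Take [moment_le] with [- logprof n], whose half Laplacian is at most [1]: the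
    heat kernel enters with the favourable sign. The constant is the value at the
    starting point, bounded uniformly in [n] because [0 <> x]. *)
Lemma mean_log t mu : x != 0 -> 0 <= t -> is_mean_measure P X t mu ->
  mu [set x] = 0%E /\ (\int[mu]_y `|log_dist x y|%:E < +oo)%E.
Proof.
move=> x0 t0 muE; have [nu nuE] := occupation_exists P hF cX aX t0.
have q0 : 0 < sqdist x 0 by rewrite sqdist_gt0 eq_sym.
pose C := `|2^-1 * ln (sqdist x 0)| + (sqdist x 0 + 2 * t) + t.
have [||||||||mx hs] := @fatou_singular _ _ R mu x
  (fun n y => `|logprof n.+1%:R (sqdist x y)|) (fun y => `|log_dist x y|) C.
- exact: measurable_set_pt.
- move=> n; apply: measurableT_comp => //.
  by have [h _] := @logprof_Cb2 _ x n.+1%:R (ltr0Sn _ _); exact: Cb2_measurable h.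
- by apply: measurableT_comp => //; exact: measurable_log_dist.
- by [].
- by [].
- move=> y yx; apply: cvg_norm; rewrite log_distE; apply: logprof_cvg.
  by rewrite sqdist_gt0; exact/eqP.
- move=> A; rewrite (_ : sqdist x x = 0); first exact: logprof0_cvg.
  by apply/eqP; rewrite sqdist_eq0.
- move=> n; have n0 : 0 < n.+1%:R :> R by [].
  have [h l] := logprof_Cb2 x n0.
  have H : (\int[mu]_y `|logprof n.+1%:R (sqdist x y)|%:E + \int[nu]_y (cst (0 : R) y)%:E <=
      `|2^-1 * ln (sqdist x 0)|%:E +
      (\int[mu]_y (sqdist x y)%:E + \int[nu]_y (cst (1 : R) y)%:E))%E.
    apply: (moment_le hF hX (sg := -1) h t0 muE (fun f f0 mf => (nuE f f0 mf).1)) => //.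
    + by apply: measurableT_comp => //; exact: Cb2_measurable h.
    + exact: measurable_sqdist.
    + exact: sqdist_ge0.
    (* With [h] the profile: where [h <= 0], [|h| = - h]; elsewhere [q > 1] and
       [2 h <= ln q <= q]. *)
    + move=> y; rewrite mulN1r /=; have := sqdist_ge0 x y.
      move: (sqdist x y) => q; rewrite le_eqVlt => /predU1P[<-|q1].
        have := logprof_homo n.+1%:R (@ler01 R); rewrite logprof1 => l0.
        by rewrite ler0_norm//; lra.
      have hb := logprof_bound n0 q1.
      have [l0|l0] := leP (logprof n.+1%:R q) 0; first by rewrite ler0_norm//; lra.
      have q2 : 1 < q.
        rewrite ltNge; apply/negP => q1'.
        by have := logprof_homo n.+1%:R q1'; rewrite logprof1; lra.
      have lq : ln (1 + (q - 1)) <= q - 1 by apply: le_ln1Dx; lra.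
      have l1 : 0 <= 2^-1 * ln q by rewrite mulr_ge0// ln_ge0// ltW.
      rewrite [1 + _]addrC subrK in lq.
      rewrite (ger0_norm l1) (gtr0_norm l0) in hb.
      rewrite (gtr0_norm l0); lra.
    + move=> y; rewrite l /cst add0r mulN1r opprB.
      have q0' := sqdist_ge0 x y.
      have := lker_ge0 1 (sqdist x y) n.+1%:R; have := lker_le 1 (- n.+1%:R) q0'.
      have : expR (- n.+1%:R) <= 1 :> R by apply: expRN_le1.
      rewrite expr1; lra.
    + by move=> /=; have := logprof_bound n0 q0; rewrite ler_norml; lra.
  move: H; rewrite integral_cst0 adde0 => /le_trans; apply.
  have -> : C%:E = (`|2^-1 * ln (sqdist x 0)|%:E + ((sqdist x 0 + 2 * t)%:E + t%:E))%E.
    by rewrite -!EFinD; congr (_%:E); rewrite /C; ring.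
  apply: leeD2l; apply: leeD.
    exact: (mean_sqdist hF hX x t0 muE).
  exact: (occupation_mass hF hX t0 nuE).
split=> //; exact: le_lt_trans hs (ltry _).
Qed.

End LogMoments.

(** * The martingale problem along the approximations *)
Section Approximation.
Context {R : realType} {d : measure_display} {T : measurableType d}.
Variables (P : probability T R) (F : R -> set (set T)) (X : R -> T -> MF R).
Hypothesis hF : filtration F.
Hypothesis hX : super_brownian_motion P F X (\d_(0 : R * R)).
Variable x : R * R.

Let cX := sbm_continuous hX.
Let aX := sbm_adapted hX.

Definition logapprox (n : nat) : R * R -> R := logprof n.+1%:R \o sqdist x.

Lemma logapprox_Cb2 n : Cb2 (logapprox n).
Proof. by have [h _] := @logprof_Cb2 R x n.+1%:R (ltr0Sn _ _). Qed.

Lemma logapprox_bound n y : y <> x -> `|logapprox n y| <= `|log_dist x y|.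
Proof.
move=> yx; rewrite log_distE; apply: logprof_bound => //.
by rewrite sqdist_gt0; exact/eqP.
Qed.

Lemma logapprox_cvg y : y <> x -> logapprox n y @[n --> \oo] --> log_dist x y.
Proof.
move=> yx; rewrite log_distE; apply: logprof_cvg.
by rewrite sqdist_gt0; exact/eqP.
Qed.

Lemma lker_Cb k v : Cb (fun y => lker k (sqdist x y) v).
Proof.
split; last first.
  apply: (@bounded_funP _ _ (expR v ^+ k)) => y.
  by rewrite ger0_norm ?lker_ge0// lker_le// sqdist_ge0.
apply: (@continuous_radial _ x (fun q => lker k q v)) => q _.
exact: is_derive_continuous (is_derive_lker_param k q v).
Qed.

Lemma occB (f h : R * R -> R) t w : Cb f -> Cb h ->
  occ X (fun y => f y - h y) t w = occ X f t w - occ X h t w.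
Proof.
move=> cf ch; have icf := path_integrable hX t w cf.
have ich := path_integrable hX t w ch; rewrite /occ -RintegralB//.
by apply: eq_Rintegral => s _; rewrite RintegralB//; exact: Cb_integrable.
Qed.

Lemma occZ (a : R) (f : R * R -> R) t w : Cb f ->
  occ X (fun y => a * f y) t w = a * occ X f t w.
Proof.
move=> cf; rewrite /occ -RintegralZl//; last exact: (path_integrable hX t w cf).
by apply: eq_Rintegral => s _; rewrite RintegralZl//; exact: Cb_integrable.
Qed.

Lemma occ_le (f h : R * R -> R) t w : Cb f -> Cb h -> (forall y, f y <= h y) ->
  occ X f t w <= occ X h t w.
Proof.
move=> cf ch fh; have icf := path_integrable hX t w cf.
have ich := path_integrable hX t w ch; apply: le_Rintegral => //.
by move=> s _; apply: le_Rintegral => //; exact: Cb_integrable.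
Qed.

Lemma cvg_expRN : expR (- n.+1%:R) @[n --> \oo] --> (0 : R).
Proof. by have := @cvgn_expR R; rewrite -cvg_shiftS. Qed.

(** [lker 1 q n] is [pi] times the heat kernel at time [expR (- n) / 2]. *)
Lemma local_time_seq t L : local_time P X x t L ->
  {ae P, forall w, occ X (fun y => lker 1 (sqdist x y) n.+1%:R) t w @[n --> \oo] --> pi * L w}.
Proof.
apply: filterS => w /cvg_at_rightP hL.
have pi0 : (pi : R) != 0 by rewrite gt_eqF// pi_gt0.
have {}hL := hL (fun n => 2^-1 * expR (- n.+1%:R)).
have e n : occ X (fun y => lker 1 (sqdist x y) n.+1%:R) t w =
    pi * (\int[lebesgue_measure]_(s in `[0, t])
      \int[X s w]_y heat_kernel (2^-1 * expR (- n.+1%:R)) (y - x)).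
  rewrite -[RHS](_ : pi * occ X (fun y => heat_kernel (2^-1 * expR (- n.+1%:R)) (y - x)) t w = _)//.
  rewrite (_ : (fun y => heat_kernel _ _) =
      (fun y => pi^-1 * lker 1 (sqdist x y) n.+1%:R)).
    by rewrite (occZ pi^-1 t w (lker_Cb 1 n.+1%:R)) mulVKf.
  apply/funext => y; rewrite /heat_kernel enormB_sqr /lker [expR (- n.+1%:R)]expRN expr1.
  have en : expR n.+1%:R != 0 :> R by rewrite gt_eqF ?expR_gt0.
  have -> : sqdist x y / (2 * (2^-1 / expR n.+1%:R)) = expR n.+1%:R * sqdist x y by field.
  by move: pi0; move: pi => p p0; field; rewrite en p0.
under eq_cvg do rewrite e.
apply: cvgM; first exact: cvg_cst.
apply: hL; split; first by move=> n; rewrite mulr_gt0 ?expR_gt0// invr_gt0.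
rewrite -[X in _ --> X](mulr0 2^-1); apply: cvgM; [exact: cvg_cst|exact: cvg_expRN].
Qed.

Lemma remainder_cvg t w :
  occ X (fun y => lker 1 (sqdist x y) (- n.+1%:R)) t w @[n --> \oo] --> 0.
Proof.
have cl : (0 : R) @[n --> \oo] --> (0 : R) by exact: cvg_cst.
have cu : expR (- n.+1%:R) * occ X (cst 1) t w @[n --> \oo] --> (0 : R).
  rewrite -[X in _ --> X](mul0r (occ X (cst 1) t w)).
  by apply: cvgM; [exact: cvg_expRN|exact: cvg_cst].
apply: squeeze_cvgr cl cu; apply: nearW => n.
rewrite -(occZ _ t w (Cb_cst 1)).
apply/andP; split.
  apply: Rintegral_ge0 => s _; apply: Rintegral_ge0 => y _; exact: lker_ge0.
apply: occ_le; [exact: lker_Cb|exact: Cb_cst|].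
move=> y; rewrite mulr1; apply: le_trans (lker_le _ _ (sqdist_ge0 x y)) _.
by rewrite expr1.
Qed.

Lemma ae_off_pt (nu : {measure set (R * R)%type -> \bar R}) (Q : R * R -> Prop) :
  nu [set x] = 0%E -> (forall y, y <> x -> Q y) -> {ae nu, forall y, Q y}.
Proof.
move=> nx h; exists [set x]; split => //; first exact: measurable_set_pt.
by move=> y /= nQ; apply: contrapT => yx; exact/nQ/h.
Qed.

(** Dominated convergence off [x]; at [x] the approximations diverge while
    [log_dist x x = 0], so that [x] has to be a null point. *)
Lemma log_integral_cvg (m : {measure set (R * R)%type -> \bar R}) :
  m [set x] = 0%E -> (\int[m]_y `|log_dist x y|%:E < +oo)%E ->
  m.-integrable setT (EFin \o log_dist x) /\
  \int[m]_y logapprox n y @[n --> \oo] --> \int[m]_y log_dist x y.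
Proof.
move=> mx mi.
have ig : m.-integrable setT (fun y => `|log_dist x y|%:E).
  apply/integrableP; split.
    apply/measurable_EFinP; apply: measurableT_comp => //; exact: measurable_log_dist.
  rewrite (eq_integral (fun y => `|log_dist x y|%:E))// => y _.
  by rewrite gee0_abs// lee_fin.
have [|||||ilog _ h] := @dominated_convergence _ _ R m setT measurableT
  (fun n y => (logapprox n y)%:E) (EFin \o log_dist x) (fun y => `|log_dist x y|%:E).
- by move=> n; apply/measurable_EFinP; exact: Cb2_measurable (logapprox_Cb2 n).
- by apply/measurable_EFinP; exact: measurable_log_dist.
- apply: ae_off_pt mx _ => y yx _; apply: cvg_EFin; first exact: nearW.
  exact: logapprox_cvg.
- by [].
- by apply: ae_off_pt mx _ => y yx n _; rewrite lee_fin logapprox_bound.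
split=> //; apply: fine_cvg; rewrite fineK; first exact: h.
exact: integrable_fin_num.
Qed.

End Approximation.

(** * The extended martingale and the Tanaka formula *)
(** By Fatou the lower limit has integral zero. This avoids extracting an almost
    surely convergent subsequence. *)
Lemma ae_lim0_of_integral_cvg0 d (T : measurableType d) (R : realType)
    (m : {measure set T -> \bar R}) (f_ : nat -> T -> R) :
  (forall n, measurable_fun setT (f_ n)) -> (forall n w, 0 <= f_ n w) ->
  (\int[m]_w (f_ n w)%:E)%E @[n --> \oo] --> 0%E ->
  {ae m, forall w l, f_ n w @[n --> \oo] --> l -> l = 0}.
Proof.
move=> mf f0 cf.
have mE n : measurable_fun setT (EFin \o f_ n) by exact/measurable_EFinP.
have fE0 n w : (0 <= (f_ n w)%:E)%E by rewrite lee_fin.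
pose G w := limn_einf (fun n => (f_ n w)%:E).
have mG : measurable_fun setT G.
  apply: measurableT_comp; first exact: oppe_measurable.
  apply: measurable_fun_limn_esup => n.
  by apply: measurableT_comp; [exact: oppe_measurable|exact: mE].
have G0 w : (0 <= G w)%E.
  rewrite /G limn_einf_lim; apply: lime_ge; first exact: is_cvg_einfs.
  by apply: nearW => n; apply: le_ereal_inf_tmp => _ [k _ <-].
have iG : (\int[m]_w `|G w| = 0)%E.
  rewrite (eq_integral G); last by move=> w _; rewrite gee0_abs.
  apply/eqP; rewrite eq_le integral_ge0// andbT.
  have := fatou m measurableT mE (fun n w _ => fE0 n w).
  by move=> /le_trans; apply; have [-> _] := cvg_limn_einf_sup cf.
have /(ae_eq_integral_abs m measurableT mG) := iG.
apply: filterS => w /(_ I) Gw l fl.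
have fl' : (f_ n w)%:E @[n --> \oo] --> l%:E.
  by apply: cvg_EFin; [exact: nearW|exact: fl].
by have [e _] := cvg_limn_einf_sup fl'; move: Gw; rewrite /G e => -[].
Qed.

Section Tanaka.
Context {R : realType} {d : measure_display} {T : measurableType d}.
Variables (P : probability T R) (F : R -> set (set T)) (X : R -> T -> MF R).
Hypothesis hF : filtration F.
Hypothesis hX : super_brownian_motion P F X (\d_(0 : R * R)).
Variable x : R * R.
Hypothesis x0 : x != 0.

Let cX := sbm_continuous hX.
Let aX := sbm_adapted hX.

Lemma log_integrable_ae t : 0 <= t -> {ae P, forall w, X t w [set x] = 0%E /\
  (\int[X t w]_y `|log_dist x y|%:E < +oo)%E}.
Proof.
move=> t0; have [mu muE] := mean_measure_exists P hF aX t0.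
have [mx mi] := mean_log hF hX x0 t0 muE.
have mpt := measurable_set_pt x.
have h1 : {ae P, forall w, X t w [set x] = 0%E}.
  have mXx : measurable_fun setT (fun w => X t w [set x] : \bar R).
    exact: (measurable_kerT hF aX).
  have e : (\int[P]_w `|X t w [set x]| = 0)%E.
    rewrite (eq_integral (fun w => \int[X t w]_y (\1_[set x] y)%:E))%E; last first.
      by move=> w _; rewrite integral_indic// setIT gee0_abs.
    rewrite -muE; first by rewrite integral_indic// setIT.
      by move=> y; rewrite lee_fin indicE.
    by apply/measurable_EFinP; exact: measurable_indic.
  have /(ae_eq_integral_abs P measurableT mXx) := e.
  by apply: filterS => w /(_ I).
have ml : measurable_fun setT (fun y => `|log_dist x y|%:E : \bar R).
  by apply/measurable_EFinP; apply: measurableT_comp => //; exact: measurable_log_dist.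
have l0 y : (0 <= `|log_dist x y|%:E)%E by rewrite lee_fin.
have I0 w : (0 <= \int[X t w]_y `|log_dist x y|%:E)%E by exact: integral_ge0.
have h2 : {ae P, forall w, (\int[X t w]_y `|log_dist x y|%:E < +oo)%E}.
  have ii : P.-integrable setT (fun w => \int[X t w]_y `|log_dist x y|%:E)%E.
    apply/integrableP; split.
      apply: (@measurable_fun_integral_kernel _ _ T _ R (fun w => MF_measure (X t w))) => //.
      by move=> U mU; exact: (measurable_kerT hF aX).
    rewrite (eq_integral (fun w => \int[X t w]_y `|log_dist x y|%:E))%E.
      by rewrite -muE.
    by move=> w _; rewrite gee0_abs.
  have := integrable_ae measurableT ii.
  by apply: filterS => w /(_ I); rewrite ge0_fin_numE.
by apply: filterS2 h1 h2.
Qed.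

(** Each term of the martingale problem converges along almost every path: the
    half Laplacian contributes [pi] times the local time. *)
Lemma mp_logapprox_cvg t L : 0 <= t -> local_time P X x t L ->
  {ae P, forall w, mp_martingale X (logapprox x n) t w @[n --> \oo] -->
     \int[X t w]_y log_dist x y - log_dist x 0 - pi * L w}.
Proof.
move=> t0 hL.
have := init_test hX; have := local_time_seq hX hL; have := log_integrable_ae t0.
apply: filterS3 => w [Xx Xi] cL X0.
have [_ cl] := log_integral_cvg Xx Xi.
have e n : mp_martingale X (logapprox x n) t w =
    \int[X t w]_y logapprox x n y - logapprox x n 0 -
    (occ X (fun y => lker 1 (sqdist x y) n.+1%:R) t w -
     occ X (fun y => lker 1 (sqdist x y) (- n.+1%:R)) t w).
  rewrite /mp_martingale X0; last exact: Cb2_measurable (logapprox_Cb2 x n).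
  rewrite -(occB hX t w (lker_Cb x 1 n.+1%:R) (lker_Cb x 1 (- n.+1%:R))).
  congr (_ - _); apply: eq_Rintegral => s _; apply: eq_Rintegral => y _.
  by have [_ ->] := @logprof_Cb2 R x n.+1%:R (ltr0Sn _ _).
under eq_cvg do rewrite e.
apply: cvgB; first apply: cvgB => //.
  by apply: logapprox_cvg => /eqP; rewrite eq_sym (negbTE x0).
rewrite -[X in _ --> X]subr0; apply: cvgB => //.
exact: (remainder_cvg hX).
Qed.

Lemma energyE f t nu : measurable_fun setT f -> is_occupation_measure P X t nu ->
  energy P X f t = (\int[nu]_y ((f y) ^+ 2)%:E)%E.
Proof.
move=> mf nuE.
have h0 y : (0 <= ((f y) ^+ 2)%:E)%E by rewrite lee_fin sqr_ge0.
have hm : measurable_fun setT (fun y => ((f y) ^+ 2)%:E : \bar R).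
  by apply/measurable_EFinP; exact: measurable_funX.
by have [-> _] := nuE _ h0 hm.
Qed.

Lemma sqr_log_bound (f : R * R -> R) y : `|f y| <= 2 * `|log_dist x y| ->
  f y ^+ 2 <= 4 * log_dist x y ^+ 2.
Proof.
move=> h; rewrite -[f y ^+ 2]real_normK ?num_real// -[log_dist x y ^+ 2]real_normK ?num_real//.
rewrite (_ : 4 * _ = (2 * `|log_dist x y|) ^+ 2); last ring.
by rewrite lerXn2r ?nnegrE// mulr_ge0.
Qed.

Lemma integrable_sqr_log t nu : 0 <= t -> is_occupation_measure P X t nu ->
  nu.-integrable setT (fun y => (4 * log_dist x y ^+ 2)%:E).
Proof.
move=> t0 nuE; have [nx ni] := occupation_log hF hX x t0 nuE.
have mg : measurable_fun setT (fun y => log_dist x y ^+ 2).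
  by apply: measurable_funX; exact: measurable_log_dist.
have ig : nu.-integrable setT (EFin \o (fun y => log_dist x y ^+ 2)).
  apply/integrableP; split; first exact/measurable_EFinP.
  rewrite (eq_integral (fun y => (log_dist x y ^+ 2)%:E))// => y _.
  by rewrite gee0_abs// lee_fin sqr_ge0.
by have := integrableZl measurableT 4 ig.
Qed.

(** Off [x] is enough because the occupation measure does not charge [x]. *)
Lemma finite_energy_log_bound (f : R * R -> R) : measurable_fun setT f ->
  (forall y, y <> x -> `|f y| <= 2 * `|log_dist x y|) -> finite_energy P X f.
Proof.
move=> mf fb; split=> // t t0.
have [nu nuE] := occupation_exists P hF cX aX t0.
have [nx _] := occupation_log hF hX x t0 nuE.
have /integrableP[m4 i4] := integrable_sqr_log t0 nuE.
rewrite (energyE mf nuE); apply: le_lt_trans i4.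
apply: ae_ge0_le_integral => //.
- by move=> y _; rewrite lee_fin sqr_ge0.
- by apply/measurable_EFinP; exact: measurable_funX.
- exact: measurableT_comp.
- apply: ae_off_pt nx _ => y yx _.
  rewrite gee0_abs; first exact/sqr_log_bound/fb.
  by rewrite lee_fin; apply: mulr_ge0 => //; exact: sqr_ge0.
Qed.

Definition logdiff n : R * R -> R := (-1) *: log_dist x + logapprox x n.

Lemma logdiffE n y : logdiff n y = logapprox x n y - log_dist x y.
Proof. by rewrite /logdiff addrC scaleN1r. Qed.

Lemma measurable_logapprox n : measurable_fun setT (logapprox x n).
Proof. exact: Cb2_measurable (logapprox_Cb2 x n). Qed.

Lemma measurable_logdiff n : measurable_fun setT (logdiff n).
Proof.
rewrite (_ : logdiff n = (fun y => logapprox x n y - log_dist x y)); last first.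
  by apply/funext => y; rewrite logdiffE.
by apply: measurable_funB; [exact: measurable_logapprox|exact: measurable_log_dist].
Qed.

Lemma logdiff_bound n y : y <> x -> `|logdiff n y| <= 2 * `|log_dist x y|.
Proof.
move=> yx; rewrite logdiffE; have := logapprox_bound n yx.
by have := ler_normB (logapprox x n y) (log_dist x y); lra.
Qed.

Lemma energy_logdiff_cvg t : 0 <= t -> energy P X (logdiff n) t @[n --> \oo] --> 0%E.
Proof.
move=> t0; have [nu nuE] := occupation_exists P hF cX aX t0.
have [nx _] := occupation_log hF hX x t0 nuE.
under eq_cvg do rewrite (energyE (measurable_logdiff _) nuE).
have [|||||_ _ h] := @dominated_convergence _ _ R nu setT measurableT
  (fun n y => (logdiff n y ^+ 2)%:E) (cst 0%E) (fun y => (4 * log_dist x y ^+ 2)%:E).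
- by move=> n; apply/measurable_EFinP; apply: measurable_funX; exact: measurable_logdiff.
- exact: measurable_cst.
- apply: ae_off_pt nx _ => y yx _; apply: cvg_EFin; first exact: nearW.
  have c : logdiff n y @[n --> \oo] --> (0 : R).
    have h : logapprox x n y - log_dist x y @[n --> \oo] -->
        log_dist x y - log_dist x y.
      by apply: cvgB; [exact: logapprox_cvg|exact: cvg_cst].
    by rewrite subrr in h; under eq_cvg do rewrite logdiffE.
  by rewrite -[X in _ --> X](mulr0 0); exact: (cvgM c c).
- exact: integrable_sqr_log t0 nuE.
- apply: ae_off_pt nx _ => y yx n _; rewrite gee0_abs ?lee_fin ?sqr_ge0//.
  exact/sqr_log_bound/logdiff_bound.
by move: h; rewrite integral_cst// mul0e.
Qed.

Variable M : (R * R -> R) -> R -> T -> R.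
Hypothesis hM : martingale_extension P X M.

(** Along the approximations, the extended martingale is that of the martingale
    problem. It converges pathwise by [mp_logapprox_cvg], and in mean square to
    the extended martingale of the logarithm by the isometry and
    [energy_logdiff_cvg]; the limits agree. *)
Lemma tanaka t L : 0 <= t -> local_time P X x t L ->
  {ae P, forall w, (\int[X t w]_y (log_dist x y)%:E)%E =
      (\int[X t w]_y log_dist x y)%:E /\
    M (log_dist x) t w = \int[X t w]_y log_dist x y - log_dist x 0 - pi * L w}.
Proof.
move=> t0 hL.
have feg : finite_energy P X (log_dist x).
  apply: finite_energy_log_bound; first exact: measurable_log_dist.
  by move=> y _; have := normr_ge0 (log_dist x y); lra.
have fea n : finite_energy P X (logapprox x n).
  apply: finite_energy_log_bound; first exact: measurable_logapprox.
  move=> y yx; have := logapprox_bound n yx.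
  by have := normr_ge0 (log_dist x y); lra.
have fed n : finite_energy P X (logdiff n).
  apply: finite_energy_log_bound; first exact: measurable_logdiff.
  exact: logdiff_bound.
have L2 : (\int[P]_w ((M (logdiff n) t w) ^+ 2)%:E)%E @[n --> \oo] --> 0%E.
  under eq_cvg do rewrite (mext_isometry hM (fed _) t0).
  exact: energy_logdiff_cvg.
have := ae_lim0_of_integral_cvg0 _ _ L2.
move=> /(_ (fun n => measurable_funX 2 (mext_rv hM (fed n) t0))).
move=> /(_ (fun n w => sqr_ge0 _)) lim0.
have lin : {ae P, forall w, forall n, M (logdiff n) t w =
    -1 * M (log_dist x) t w + mp_martingale X (logapprox x n) t w}.
  apply: ae_foralln => n.
  have h1 := mext_linear hM (-1) feg (fea n) t0.
  have h2 := mext_Cb2 hM (logapprox_Cb2 x n) t0.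
  by apply: filterS2 h1 h2 => w -> ->.
have A := log_integrable_ae t0; have B := mp_logapprox_cvg t0 hL.
apply: filterS2 (filterI lim0 lin) (filterI A B) => w [l0 li] [[Xx Xi] cm].
have [ilog _] := log_integral_cvg Xx Xi.
split; first by rewrite /Rintegral fineK//; exact: integrable_fin_num.
have c : M (logdiff n) t w @[n --> \oo] --> -1 * M (log_dist x) t w +
    (\int[X t w]_y log_dist x y - log_dist x 0 - pi * L w).
  under eq_cvg do rewrite li.
  by apply: cvgD => //; exact: cvg_cst.
have h0 := l0 _ (cvgM c c).
have /eqP := h0 eventually_filter; rewrite mulf_eq0 orbb => /eqP; lra.
Qed.

End Tanaka.

Theorem proposition3 (R : realType) (d : measure_display)
    (T : measurableType d) (P : probability T R) (F : R -> set (set T))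
    (X : R -> T -> MF R) (M : (R * R -> R) -> R -> T -> R)
    (x : R * R) (L : R -> T -> R)
    (hF : filtration F)
    (hX : super_brownian_motion P F X (\d_(0 : R * R)))
    (hM : martingale_extension P X M)
    (hx : x != 0)
    (hL : forall t, 0 < t -> local_time P X x t (L t)) :
  forall t, 0 < t ->
    {ae P, forall w,
      ((L t w)%:E = (pi^-1)%:E *
        (\int[X t w]_y (log_dist x y)%:E
         - \int[\d_(0%R : R * R)]_y (log_dist x y)%:E
         - (M (log_dist x) t w)%:E))%E}.
Proof.
move=> t t0; apply: filterS (tanaka hF hX hx hM (ltW t0) (hL t t0)) => w [-> ->].
rewrite integral_dirac//; last by apply/measurable_EFinP; exact: measurable_log_dist.
rewrite diracT mul1e -!EFinB -EFinM; congr (_%:E).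
have : (pi : R) != 0 by rewrite gt_eqF// pi_gt0.
by move: (pi : R) => p p0; field.
Qed.
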